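(* Assume that $|\chi|=s<\infty$. Then $$\left\{V_t(\lambda),\ V(\sigma,f^t)\ \middle|\ \lambda\in\widehat{G},\ [\sigma]\in\widehat{G}/\langle\chi\rangle,\ t\geq 1,\ f(y)\in\mathrm{Irr}[y]\right\}$$ (one $\sigma$ being chosen in each class $[\sigma]$) is a representative set of isomorphism classes of finite dimensional indecomposable objects in $\mathcal{W}$.
   Context: $k$ is a field, $G$ a group, $\widehat{G}$ the group of characters $G\to k^{\times}$, $\chi\in\widehat{G}$ of order $|\chi|$, and $a\in Z(G)$ with $\chi(a)\neq 1$. $H=kG(\chi^{-1},a,0)$ is the Hopf algebra generated as an algebra by $G$ and $x$ with relations $xg=\chi^{-1}(g)gx$ ($g\in G$), having $k$-basis $\{gx^i\mid g\in G,i\geq 0\}$, with $\Delta(x)=x\otimes a+1\otimes x$, $\varepsilon(x)=0$, $S(x)=-xa^{-1}$, and each $g\in G$ group-like. For an $H$-module $M$ and $\lambda\in\widehat{G}$, $M_{(\lambda)}=\{v\in M\mid g\cdot v=\lambda(g)v\ \forall g\in G\}$. $M$ is a weight module if $M=\bigoplus_{\lambda\in\widehat{G}}M_{(\lambda)}$; $\mathcal{W}$ is the full subcategory of left $H$-modules consisting of all weight modules. $\langle\chi\rangle$ is the subgroup of $\widehat{G}$ generated by $\chi$ and $[\sigma]$ is the class of $\sigma$ in $\widehat{G}/\langle\chi\rangle$. For $t\geq 1$ and $\lambda\in\widehat{G}$, $V_t(\lambda)$ is the $t$-dimensional $H$-module with $k$-basis $m_0,\dots,m_{t-1}$ and action $g\cdot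 m_i=\chi^i(g)\lambda(g)m_i$; $x\cdot m_i=m_{i+1}$ for $0\leq i\leq t-2$; $x\cdot m_{t-1}=0$. $V(\lambda,f)$ (for $|\chi|=s<\infty$): for $\lambda\in\widehat{G}$ and a monic polynomial $f(y)=y^n-\sum_{j=0}^{n-1}\alpha_jy^j\in k[y]$ of degree $n\geq 1$, $V(\lambda,f)$ is the $H$-module with $k$-basis $m_0,\dots,m_{ns-1}$ and action $g\cdot m_i=\chi^i(g)\lambda(g)m_i$; $x\cdot m_i=m_{i+1}$ for $0\leq i\leq ns-2$; $x\cdot m_{ns-1}=\sum_{j=0}^{n-1}\alpha_jm_{js}$. $V(\sigma,f^t)$ is this module for the monic polynomial $f(y)^t$. $\mathrm{Irr}[y]$ is the set of monic irreducible polynomials $f(y)\in k[y]$ with $f(y)\neq y$. *)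

(* Defs.v *)
From HB Require Import structures.
From mathcomp Require Import all_boot all_order all_algebra.
From mathcomp Require Import finmap boolp monalg.

Set Implicit Arguments.
Unset Strict Implicit.
Unset Printing Implicit Defensive.

Import GRing.Theory.
Local Open Scope ring_scope.

Section Characters.
Variables (G : groupType) (k : fieldType).

(* Characters take values in [k], but the two axioms force them to be
   invertible (see [char_neq0]). *)
Record character : Type := Character {
  char_val :> G -> k;
  char_val1 : char_val 1%g = 1;
  char_valM : forall g h : G, char_val (g * h)%g = char_val g * char_val h
}.

Implicit Types lambda mu nu : character.

Lemma charP lambda mu : (forall g, lambda g = mu g) -> lambda = mu.
Proof.
case: lambda mu => [f f1 fM] [g g1 gM] /= /funext fg.
by subst g; congr Character; apply: Prop_irrelevance.
Qed.

Lemma char_neq0 lambda g : lambda g != 0.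
Proof.
apply/eqP => l0; have := char_val1 lambda.
by rewrite -(mulgV g) char_valM l0 mul0r => /esym/eqP; rewrite oner_eq0.
Qed.

HB.instance Definition _ := gen_eqMixin character.
HB.instance Definition _ := gen_choiceMixin character.

Definition char_one : character :=
  @Character (fun=> 1) erefl (fun _ _ => esym (mulr1 1)).

Fact char_mul1 lambda mu : lambda 1%g * mu 1%g = 1.
Proof. by rewrite !char_val1 mulr1. Qed.

Fact char_mulM lambda mu g h :
  lambda (g * h)%g * mu (g * h)%g = lambda g * mu g * (lambda h * mu h).
Proof. by rewrite !char_valM mulrACA. Qed.

Definition char_mul lambda mu : character :=
  Character (char_mul1 lambda mu) (char_mulM lambda mu).

Fact char_inv1 lambda : (lambda 1%g)^-1 = 1.
Proof. by rewrite char_val1 invr1. Qed.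

Fact char_invM lambda g h :
  (lambda (g * h)%g)^-1 = (lambda g)^-1 * (lambda h)^-1.
Proof. by rewrite char_valM invfM. Qed.

Definition char_inv lambda : character :=
  Character (char_inv1 lambda) (char_invM lambda).

Fact char_mulA : associative char_mul.
Proof. by move=> l m n; apply: charP => g /=; rewrite mulrA. Qed.

Fact char_mul1l : left_id char_one char_mul.
Proof. by move=> l; apply: charP => g /=; rewrite mul1r. Qed.

Fact char_mul1r : right_id char_one char_mul.
Proof. by move=> l; apply: charP => g /=; rewrite mulr1. Qed.

Fact char_mulVl : left_inverse char_one char_inv char_mul.
Proof. by move=> l; apply: charP => g /=; rewrite mulVf ?char_neq0. Qed.

Fact char_mulVr : right_inverse char_one char_inv char_mul.
Proof. by move=> l; apply: charP => g /=; rewrite mulfV ?char_neq0. Qed.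

HB.instance Definition _ := isGroup.Build character
  char_mulA char_mul1l char_mul1r char_mulVl char_mulVr.

Lemma char_mulE lambda mu g : (lambda * mu)%g g = lambda g * mu g.
Proof. by []. Qed.

Lemma char_oneE g : (1%g : character) g = 1.
Proof. by []. Qed.

Lemma char_invE lambda g : (lambda^-1)%g g = (lambda g)^-1.
Proof. by []. Qed.

Lemma char_expE lambda n g : (lambda ^+ n)%g g = lambda g ^+ n.
Proof. by elim: n => // n IHn; rewrite expgS exprS char_mulE IHn. Qed.

Definition has_order (chi : character) (s : nat) : Prop :=
  [/\ (0 < s)%N, (chi ^+ s = 1)%g
    & forall i, (0 < i < s)%N -> (chi ^+ i <> 1)%g].

Definition in_cyclic (chi mu : character) : Prop :=
  exists n : nat, (mu = chi ^+ n)%g \/ (mu = chi ^- n)%g.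

Definition same_class (chi sigma tau : character) : Prop :=
  in_cyclic chi (sigma^-1 * tau)%g.

Definition class_transversal (chi : character) (T : character -> Prop) : Prop :=
  forall lambda, exists! sigma, T sigma /\ same_class chi sigma lambda.

End Characters.

(* The algebra [kG(chi^-1, a, 0)]: the free [k]-module on the basis
   [g x^i <-> (g, i)], with the product
   [(g x^i) (h x^j) = chi^-1(h)^i g h x^(i+j)] forced by
   [x h = chi^-1(h) h x].  Neither [a] nor the coalgebra structure enters
   the algebra structure, which alone determines the category of modules. *)
Definition hopf_ore (G : groupType) (k : fieldType) (chi : character G k) :
  Type := {malg k[(G * nat)%type]}.

Section HopfOre.
Variables (G : groupType) (k : fieldType) (chi : character G k).

Local Notation B := (G * nat)%type.
Local Notation H := (hopf_ore chi).

HB.instance Definition _ := GRing.Lmodule.copy H {malg k[(G * nat)%type]}.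

Implicit Types (u v w : B) (p q r : H).

Definition hb_mul u v : B := ((u.1 * v.1)%g, (u.2 + v.2)%N).
Definition hb_twist u v : k := (chi^-1)%g v.1 ^+ u.2.
Definition hb u : H := mkmalgU u 1.

Definition hmul p q : H :=
  \sum_(u <- msupp p) \sum_(v <- msupp q)
    (p@_u * q@_v * hb_twist u v) *: hb (hb_mul u v).

Lemma hZU (c : k) u : c *: hb u = mkmalgU u c.
Proof. by apply/malgP=> v; rewrite mcoeffZ !mcoeffU mulrnAr mulr1. Qed.

Lemma hmulw (d1 d2 : {fset B}) p q :
  (msupp p `<=` d1)%fset -> (msupp q `<=` d2)%fset ->
  hmul p q = \sum_(u <- d1) \sum_(v <- d2)
    (p@_u * q@_v * hb_twist u v) *: hb (hb_mul u v).
Proof.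
move=> le1 le2; rewrite /hmul (big_fset_incl _ le1) /=.
  apply/eq_bigr=> u _; apply/big_fset_incl => // v _ /mcoeff_outdom ->.
  by rewrite mulr0 mul0r scale0r.
move=> u _ /mcoeff_outdom pu.
by rewrite big1 => // v _; rewrite pu !mul0r scale0r.
Qed.

Lemma hmulDl : left_distributive hmul +%R.
Proof.
move=> p q r.
rewrite [in RHS](hmulw (fsubsetUl (msupp p) (msupp q)) (fsubset_refl (msupp r))).
rewrite [in RHS](hmulw (fsubsetUr (msupp p) (msupp q)) (fsubset_refl (msupp r))).
rewrite (hmulw (msuppD_le _ _) (fsubset_refl (msupp r))).
rewrite -big_split /=; apply/eq_bigr=> u _.
rewrite -big_split /=; apply/eq_bigr=> v _.
by rewrite mcoeffD !mulrDl scalerDl.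
Qed.

Lemma hmulDr : right_distributive hmul +%R.
Proof.
move=> r p q.
rewrite [in RHS](hmulw (fsubset_refl (msupp r)) (fsubsetUl (msupp p) (msupp q))).
rewrite [in RHS](hmulw (fsubset_refl (msupp r)) (fsubsetUr (msupp p) (msupp q))).
rewrite (hmulw (fsubset_refl (msupp r)) (msuppD_le _ _)).
rewrite -big_split /=; apply/eq_bigr=> u _.
rewrite -big_split /=; apply/eq_bigr=> v _.
by rewrite mcoeffD mulrDr mulrDl scalerDl.
Qed.

Lemma hmulZl (c : k) p q : c *: hmul p q = hmul (c *: p) q.
Proof.
rewrite (hmulw (msuppZ_le c p) (fsubset_refl (msupp q))) /hmul scaler_sumr.
apply/eq_bigr=> u _; rewrite scaler_sumr; apply/eq_bigr=> v _.
by rewrite scalerA mcoeffZ !mulrA.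
Qed.

Lemma hmulZr (c : k) p q : c *: hmul p q = hmul p (c *: q).
Proof.
rewrite (hmulw (fsubset_refl (msupp p)) (msuppZ_le c q)) /hmul scaler_sumr.
apply/eq_bigr=> u _; rewrite scaler_sumr; apply/eq_bigr=> v _.
by rewrite scalerA mcoeffZ !mulrA [c * _]mulrC.
Qed.

Lemma hmul0l : left_zero 0 hmul.
Proof. by move=> p; rewrite /hmul msupp0 big_seq_fset0. Qed.

Lemma hmul0r : right_zero 0 hmul.
Proof. by move=> p; rewrite /hmul big1 // => u _; rewrite msupp0 big_seq_fset0. Qed.

Lemma hmulbb u v : hmul (hb u) (hb v) = hb_twist u v *: hb (hb_mul u v).
Proof.
rewrite (hmulw msuppU_le msuppU_le) !big_seq_fset1 !mcoeffUU.
by rewrite !mul1r.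
Qed.

Lemma hbE p : p = \sum_(u <- msupp p) p@_u *: hb u.
Proof.
by rewrite {1}[p]monalgE; apply: eq_bigr => u _; rewrite hZU.
Qed.

Lemma hb_ind (P : H -> Prop) :
  P 0 -> (forall p q, P p -> P q -> P (p + q)) ->
  (forall c p, P p -> P (c *: p)) -> (forall u, P (hb u)) -> forall p, P p.
Proof.
move=> P0 PD PZ Pb p; rewrite [p]hbE.
by elim/big_ind: _ => // u _; apply/PZ/Pb.
Qed.

Lemma hmulA : associative hmul.
Proof.
elim/hb_ind=> [||c p IH|u] => [q r|p p' IH IH' q r|q r|].
- by rewrite !hmul0l.
- by rewrite !hmulDl IH IH'.
- by rewrite -!hmulZl IH.
elim/hb_ind=> [||c p IH|v] => [r|p p' IH IH' r|r|].
- by rewrite hmul0r !hmul0l hmul0r.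
- by rewrite hmulDr !hmulDl hmulDr IH IH'.
- by rewrite -hmulZr -!hmulZl -hmulZr IH.
elim/hb_ind=> [|p p' IH IH'|c p IH|w].
- by rewrite !hmul0r.
- by rewrite !hmulDr IH IH'.
- by rewrite -!hmulZr IH.
rewrite !hmulbb -hmulZr -hmulZl !hmulbb !scalerA; congr (_ *: hb _); last first.
  by rewrite /hb_mul /= mulgA addnA.
by rewrite /hb_twist char_valM exprMn exprD mulrCA [X in _ * X]mulrC.
Qed.

Definition hone : H := hb (1%g, 0%N).

Lemma hmul1l : left_id hone hmul.
Proof.
elim/hb_ind=> [|p q IHp IHq|c p IHp|u]; rewrite ?hmul0r ?hmulDr -?hmulZr ?IHp ?IHq //.
by rewrite hmulbb /hb_twist expr0 scale1r /hb_mul mul1g; case: u.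
Qed.

Lemma hmul1r : right_id hone hmul.
Proof.
elim/hb_ind=> [|p q IHp IHq|c p IHp|u]; rewrite ?hmul0l ?hmulDl -?hmulZl ?IHp ?IHq //.
rewrite hmulbb /hb_twist char_val1 expr1n scale1r /hb_mul mulg1 addn0.
by case: u.
Qed.

Lemma hone_neq0 : hone != 0.
Proof. by apply/eqP/malgP=> /(_ (1%g, 0%N))/eqP; rewrite !mcoeffsE oner_eq0. Qed.

HB.instance Definition _ := GRing.Zmodule_isNzRing.Build H
  hmulA hmul1l hmul1r hmulDl hmulDr hone_neq0.
HB.instance Definition _ := GRing.Lmodule_isLalgebra.Build k H hmulZl.
HB.instance Definition _ := GRing.Lalgebra_isAlgebra.Build k H hmulZr.

Definition hgrp (g : G) : H := hb (g, 0%N).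
Definition hx : H := hb (1%g, 1%N).

Lemma hgrp1 : hgrp 1%g = 1. Proof. by []. Qed.

Lemma hgrpM g h : hgrp (g * h)%g = hgrp g * hgrp h.
Proof. by rewrite [RHS]hmulbb /hb_twist expr0 scale1r. Qed.

Lemma hx_hgrp g : hx * hgrp g = (chi^-1)%g g *: (hgrp g * hx).
Proof.
rewrite [in LHS]/GRing.mul [in RHS]/GRing.mul /= !hmulbb /hb_twist expr0 expr1.
by rewrite scale1r /hb_mul /= mul1g mulg1.
Qed.

Lemma hb_grpx g i : hb (g, i) = hgrp g * hx ^+ i.
Proof.
elim: i => [|i IHi]; first by rewrite expr0 mulr1.
rewrite exprSr mulrA -IHi [RHS]hmulbb /hb_twist char_val1 expr1n scale1r.
by rewrite /hb_mul mulg1 addn1.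
Qed.

End HopfOre.

Section Modules.
Variables (G : groupType) (k : fieldType) (chi : character G k).
Local Notation H := (hopf_ore chi).
Local Notation hmodType := (lmodType (hopf_ore chi)).

(* The [k]-module structure underlying an [H]-module. *)
Definition kscale (M : hmodType) (c : k) (v : M) : M := (c%:A : H) *: v.

Definition fin_dim (M : hmodType) : Prop :=
  exists (n : nat) (e : 'I_n -> M),
    forall v, exists c : 'I_n -> k, v = \sum_(i < n) kscale (c i) (e i).

Definition is_zero (M : hmodType) : Prop := forall v : M, v = 0.

Definition isomorphic (M N : hmodType) : Prop :=
  exists f : {linear M -> N}, bijective f.

Definition weight_space (M : hmodType) (lambda : character G k) (v : M) : Prop :=
  forall g : G, hgrp chi g *: v = kscale (lambda g) v.

Definition weight_module (M : hmodType) : Prop :=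
  (forall v : M, exists (L : seq (character G k)) (w : character G k -> M),
     [/\ uniq L, forall lambda, lambda \in L -> weight_space lambda (w lambda)
       & v = \sum_(lambda <- L) w lambda]) /\
  (forall (L : seq (character G k)) (w : character G k -> M), uniq L ->
     (forall lambda, lambda \in L -> weight_space lambda (w lambda)) ->
     \sum_(lambda <- L) w lambda = 0 ->
     forall lambda, lambda \in L -> w lambda = 0).

(* Decompositions are taken in the full subcategory of weight modules, whose
   finite direct sums are those of [H]-modules. *)
Definition indecomposable_weight_module (M : hmodType) : Prop :=
  [/\ weight_module M, ~ is_zero M
    & forall A B : hmodType, weight_module A -> weight_module B ->
        isomorphic M (A * B)%type -> is_zero A \/ is_zero B].

Definition fin_dim_indecomposable (M : hmodType) : Prop :=
  fin_dim M /\ indecomposable_weight_module M.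

(* The family [V], restricted to the indices satisfying [P], meets every
   isomorphism class of objects satisfying [C] exactly once. *)
Definition representative_family (C : hmodType -> Prop)
    (I : Type) (P : I -> Prop) (V : I -> hmodType) : Prop :=
  [/\ forall i, P i -> C (V i),
      forall M, C M -> exists2 i, P i & isomorphic M (V i)
    & forall i j, P i -> P j -> isomorphic (V i) (V j) -> i = j].

End Modules.

Section Representations.
Variables (G : groupType) (k : fieldType) (chi : character G k).
Local Notation H := (hopf_ore chi).

Record mx_rep (n : nat) : Type := MxRep {
  rep_g : G -> 'M[k]_n;
  rep_x : 'M[k]_n;
  rep_g1 : rep_g 1%g = 1%:M;
  rep_gM : forall g h, rep_g (g * h)%g = rep_g g *m rep_g h;
  rep_xg : forall g,
    rep_x *m rep_g g = (chi^-1)%g g *: (rep_g g *m rep_x)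
}.

Variables (n : nat) (r : mx_rep n).

Definition rep_b (u : G * nat) : 'M[k]_n := rep_g r u.1 *m rep_x r ^+ u.2.

Definition rep_eval (p : H) : 'M[k]_n := \sum_(u <- msupp p) p@_u *: rep_b u.

Lemma rep_evalw (d : {fset G * nat}) p : (msupp p `<=` d)%fset ->
  rep_eval p = \sum_(u <- d) p@_u *: rep_b u.
Proof.
move=> le; rewrite /rep_eval; apply/big_fset_incl => // u _ /mcoeff_outdom ->.
by rewrite scale0r.
Qed.

Lemma rep_evalD p q : rep_eval (p + q) = rep_eval p + rep_eval q.
Proof.
rewrite (rep_evalw (fsubsetUl (msupp p) (msupp q))).
rewrite (rep_evalw (fsubsetUr (msupp p) (msupp q))).
rewrite (rep_evalw (msuppD_le p q)) -big_split /=.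
by apply/eq_bigr=> u _; rewrite mcoeffD scalerDl.
Qed.

Lemma rep_evalZ (c : k) p : rep_eval (c *: p) = c *: rep_eval p.
Proof.
rewrite (rep_evalw (msuppZ_le c p)) scaler_sumr.
by apply/eq_bigr=> u _; rewrite mcoeffZ scalerA.
Qed.

Lemma rep_eval0 : rep_eval 0 = 0.
Proof. by rewrite -[X in rep_eval X](scale0r (0 : H)) rep_evalZ scale0r. Qed.

Lemma rep_eval_b u : rep_eval (hb chi u) = rep_b u.
Proof. by rewrite (rep_evalw msuppU_le) big_seq_fset1 mcoeffUU scale1r. Qed.

Lemma rep_eval1 : rep_eval 1 = 1%:M.
Proof. by rewrite rep_eval_b /rep_b rep_g1 expr0 mul1mx. Qed.

Lemma rep_xXg i g :
  rep_x r ^+ i *m rep_g r g = (chi^-1)%g g ^+ i *: (rep_g r g *m rep_x r ^+ i).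
Proof.
elim: i => [|i IHi]; first by rewrite !expr0 mul1mx mulmx1 scale1r.
have -> : rep_x r ^+ i.+1 = rep_x r ^+ i *m rep_x r by rewrite exprSr.
rewrite -mulmxA rep_xg -scalemxAr (mulmxA (rep_x r ^+ i)) IHi -scalemxAl.
by rewrite scalerA -exprS mulmxA.
Qed.

Lemma rep_evalM p q : rep_eval (p * q) = rep_eval p *m rep_eval q.
Proof.
elim/hb_ind: p q => [q|p p' IH IH' q|c p IH q|u].
- by rewrite mul0r rep_eval0 mul0mx.
- by rewrite mulrDl !rep_evalD mulmxDl IH IH'.
- by rewrite -scalerAl !rep_evalZ IH scalemxAl.
elim/hb_ind => [|q q' IH IH'|c q IH|v].
- by rewrite mulr0 rep_eval0 mulmx0.
- by rewrite mulrDr !rep_evalD mulmxDr IH IH'.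
- by rewrite -scalerAr !rep_evalZ IH scalemxAr.
rewrite [X in rep_eval X]hmulbb rep_evalZ !rep_eval_b /rep_b /= rep_gM exprD.
rewrite -!mulmxA [rep_x r ^+ u.2 *m (_ *m _)]mulmxA rep_xXg.
by rewrite -scalemxAl -scalemxAr -!mulmxA.
Qed.

Definition rep_module (r0 : mx_rep n) : Type := 'cV[k]_n.

HB.instance Definition _ := GRing.Zmodule.copy (rep_module r) 'cV[k]_n.

Definition rep_scale (p : H) (v : rep_module r) : rep_module r :=
  rep_eval p *m v.

Fact rep_scaleA p q v : rep_scale p (rep_scale q v) = rep_scale (p * q) v.
Proof. by rewrite /rep_scale rep_evalM mulmxA. Qed.

Fact rep_scale1 : left_id 1 rep_scale.
Proof. by move=> v; rewrite /rep_scale rep_eval1 mul1mx. Qed.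

Fact rep_scaleDr : right_distributive rep_scale +%R.
Proof. by move=> p v w; rewrite /rep_scale [LHS]mulmxDr. Qed.

Fact rep_scaleDl v : {morph rep_scale^~ v : p q / p + q}.
Proof. by move=> p q; rewrite /rep_scale rep_evalD mulmxDl. Qed.

HB.instance Definition _ := GRing.Zmodule_isLmodule.Build H (rep_module r)
  rep_scaleA rep_scale1 rep_scaleDr rep_scaleDl.

Lemma rep_scaleE (p : H) (v : rep_module r) :
  p *: v = rep_eval p *m v :> 'cV[k]_n.
Proof. by []. Qed.

Lemma rep_module_g g (v : rep_module r) :
  hgrp chi g *: v = rep_g r g *m v :> 'cV[k]_n.
Proof. by rewrite rep_scaleE rep_eval_b /rep_b expr0 mulmx1. Qed.

Lemma rep_module_x (v : rep_module r) : hx chi *: v = rep_x r *m v :> 'cV[k]_n.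
Proof. by rewrite rep_scaleE rep_eval_b /rep_b rep_g1 mul1mx expr1. Qed.

Lemma rep_module_k (c : k) (v : rep_module r) :
  kscale c v = c *: (v : 'cV[k]_n) :> 'cV[k]_n.
Proof.
by rewrite /kscale rep_scaleE rep_evalZ rep_eval1 -scalemxAl mul1mx.
Qed.

End Representations.

Section WeightModules.
Variables (G : groupType) (k : fieldType) (chi : character G k).
Local Notation H := (hopf_ore chi).

(* In the matrices below, column [j] holds the coordinates of the image of
   [m_j = delta_mx j 0]. *)

Definition weight_mx (lambda : character G k) (n : nat) (g : G) : 'M[k]_n :=
  diag_mx (\row_(i < n) (chi ^+ i * lambda)%g g).

Fact weight_mx1 lambda n : weight_mx lambda n 1%g = 1%:M.
Proof.
apply/matrixP=> i j; rewrite !mxE char_val1.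
by case: eqP.
Qed.

Fact weight_mxM lambda n g h :
  weight_mx lambda n (g * h)%g = weight_mx lambda n g *m weight_mx lambda n h.
Proof.
by rewrite /weight_mx mulmx_diag; congr diag_mx; apply/rowP=> i; rewrite !mxE char_valM.
Qed.

Fact weight_mx_x lambda n (X : 'M[k]_n) :
  (forall i j, X i j != 0 -> (chi ^+ i = chi ^+ j.+1)%g) ->
  forall g, X *m weight_mx lambda n g
    = (chi^-1)%g g *: (weight_mx lambda n g *m X).
Proof.
move=> hX g; rewrite mul_mx_diag mul_diag_mx; apply/matrixP=> i j; rewrite !mxE.
have [->|/hX eq_ij] := eqVneq (X i j) 0; first by rewrite mul0r !mulr0.
rewrite eq_ij expgS !char_mulE char_invE !mulrA mulVf ?char_neq0 // mul1r.
by rewrite -[LHS]mulrA mulrC.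
Qed.

Definition Vt_x (t : nat) : 'M[k]_t := \matrix_(i, j) (i == j.+1 :> nat)%:R.

Fact Vt_xP t i j : Vt_x t i j != 0 -> (chi ^+ i = chi ^+ j.+1)%g.
Proof. by rewrite mxE; case: (i =P j.+1 :> nat) => [->|]; rewrite ?eqxx. Qed.

Definition Vt_rep (t : nat) (lambda : character G k) : mx_rep chi t :=
  MxRep (weight_mx1 lambda t) (@weight_mxM lambda t)
    (weight_mx_x lambda (@Vt_xP t)).

Definition Vt (t : nat) (lambda : character G k) : lmodType H :=
  rep_module (Vt_rep t lambda).

Definition Vt_basis t lambda (i : 'I_t) : Vt t lambda := delta_mx i (0 : 'I_1).

(* For [f = y^n - \sum_(j < n) alpha_j y^j] one has [alpha_j = - f`_j], and
   the last basis vector is sent to [\sum_(j < n) alpha_j m_(j s)]. *)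
Definition Vpoly_x (s : nat) (f : {poly k}) : 'M[k]_((size f).-1 * s) :=
  \matrix_(i, j)
    if (j.+1 < (size f).-1 * s)%N then (i == j.+1 :> nat)%:R
    else if (s %| i)%N then - f`_(i %/ s) else 0.

Fact Vpoly_xP s (hs : has_order chi s) f i j :
  Vpoly_x s f i j != 0 -> (chi ^+ i = chi ^+ j.+1)%g.
Proof.
have [s_gt0 chis _] := hs; rewrite mxE; case: ifPn => [_|].
  by case: (i =P j.+1 :> nat) => [->|]; rewrite ?eqxx.
rewrite -leqNgt => le_j; case: ifPn => [/dvdnP[q ->] _|]; last by rewrite eqxx.
have -> : j.+1 = ((size f).-1 * s)%N by apply/eqP; rewrite eqn_leq ltn_ord le_j.
by rewrite ![(_ * s)%N]mulnC !expgnA chis !expg1n.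
Qed.

(* This is [V(lambda, f)] when [f] is monic of degree at least 1. *)
Definition Vpoly_rep s (hs : has_order chi s) (lambda : character G k)
    (f : {poly k}) : mx_rep chi ((size f).-1 * s) :=
  MxRep (weight_mx1 lambda _) (@weight_mxM lambda _)
    (weight_mx_x lambda (Vpoly_xP hs (f := f))).

Definition Vpoly s (hs : has_order chi s) (lambda : character G k)
    (f : {poly k}) : lmodType H :=
  rep_module (Vpoly_rep hs lambda f).

Definition Vpoly_basis s (hs : has_order chi s) lambda (f : {poly k})
    (i : 'I_((size f).-1 * s)) : Vpoly hs lambda f := delta_mx i (0 : 'I_1).

Lemma weight_mx_basis lambda n g (i : 'I_n) :
  weight_mx lambda n g *m delta_mx i (0 : 'I_1)
    = (chi ^+ i * lambda)%g g *: delta_mx i 0.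
Proof.
apply/colP=> j; rewrite mul_diag_mx !mxE eqxx andbT.
by case: eqVneq => [->|]; rewrite ?mulr0 ?mulr1.
Qed.

Lemma mulmx_basis n (X : 'M[k]_n) (j : 'I_n) :
  X *m delta_mx j (0 : 'I_1) = col j X.
Proof. by rewrite colE. Qed.

Lemma Vt_g t lambda g i :
  hgrp chi g *: Vt_basis lambda i
    = kscale ((chi ^+ i * lambda)%g g) (Vt_basis (t := t) lambda i).
Proof. by rewrite [LHS]rep_module_g [RHS]rep_module_k weight_mx_basis. Qed.

Lemma Vt_xS t lambda (i j : 'I_t) : j = i.+1 :> nat ->
  hx chi *: Vt_basis lambda i = Vt_basis lambda j.
Proof.
move=> ij; rewrite [LHS]rep_module_x mulmx_basis.
by apply/colP=> l; rewrite !mxE eqxx andbT -ij.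
Qed.

Lemma Vt_xlast t lambda (i : 'I_t) : i.+1 = t ->
  hx chi *: Vt_basis lambda i = 0.
Proof.
move=> ti; rewrite [LHS]rep_module_x mulmx_basis.
by apply/colP=> l; rewrite !mxE ti ltn_eqF.
Qed.

Lemma Vpoly_g s (hs : has_order chi s) lambda (f : {poly k}) g i :
  hgrp chi g *: Vpoly_basis hs lambda (f := f) i
    = kscale ((chi ^+ i * lambda)%g g) (Vpoly_basis hs lambda i).
Proof. by rewrite [LHS]rep_module_g [RHS]rep_module_k weight_mx_basis. Qed.

Lemma Vpoly_xS s (hs : has_order chi s) lambda (f : {poly k})
    (i j : 'I_((size f).-1 * s)) : j = i.+1 :> nat ->
  hx chi *: Vpoly_basis hs lambda i = Vpoly_basis hs lambda j.
Proof.
move=> ij; rewrite [LHS]rep_module_x mulmx_basis.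
by apply/colP=> l; rewrite !mxE eqxx andbT -ij ltn_ord.
Qed.

Fact Vpoly_ord s (hs : has_order chi s) (f : {poly k}) (j : 'I_(size f).-1) :
  (j * s < (size f).-1 * s)%N.
Proof. by have [s_gt0 _ _] := hs; rewrite ltn_pmul2r. Qed.

Lemma Vpoly_xlast s (hs : has_order chi s) lambda (f : {poly k})
    (i : 'I_((size f).-1 * s)) : i.+1 = ((size f).-1 * s)%N ->
  hx chi *: Vpoly_basis hs lambda i
    = \sum_(j < (size f).-1)
        kscale (- f`_j) (Vpoly_basis hs lambda (Ordinal (Vpoly_ord hs j))).
Proof.
move=> last_i; rewrite [LHS]rep_module_x mulmx_basis.
under eq_bigr do rewrite rep_module_k.
apply/colP=> l; rewrite [RHS]summxE !mxE last_i ltnn.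
under eq_bigr do rewrite !mxE eqxx andbT.
have [s_gt0 _ _] := hs.
have [/dvdnP[q def_l]|s_ndvd_l] := boolP (s %| l)%N; last first.
  rewrite big1 // => j _; case: eqP => [eq_l|_]; last by rewrite mulr0.
  by case/negP: s_ndvd_l; rewrite eq_l dvdn_mull.
have lt_q : (q < (size f).-1)%N by rewrite -(ltn_pmul2r s_gt0) -def_l.
rewrite (bigD1 (Ordinal lt_q)) //= big1 => [|j ne_j].
  by rewrite -val_eqE /= def_l mulnK // eqxx mulr1 addr0.
rewrite -val_eqE /= def_l eqn_pmul2r // -[q]/(val (Ordinal lt_q)) val_eqE.
by rewrite eq_sym (negPf ne_j) mulr0.
Qed.

End WeightModules.

Section Classification.
Variables (G : groupType) (k : fieldType) (chi : character G k).

Definition in_Irr (f : {poly k}) : Prop :=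
  [/\ f \is monic, irreducible_poly f & f <> 'X].

Inductive rep_index : Type :=
  | IdxVt of nat & character G k
  | IdxVpoly of character G k & {poly k} & nat.

Definition admissible (T : character G k -> Prop) (i : rep_index) : Prop :=
  match i with
  | IdxVt t _ => (1 <= t)%N
  | IdxVpoly sigma f t => [/\ T sigma, in_Irr f & (1 <= t)%N]
  end.

Definition rep_object s (hs : has_order chi s) (i : rep_index) :
    lmodType (hopf_ore chi) :=
  match i with
  | IdxVt t lambda => Vt chi t lambda
  | IdxVpoly sigma f t => Vpoly hs sigma (f ^+ t)
  end.

End Classification.

(* Main.v *)
From HB Require Import structures.
Require Import Defs.
From mathcomp Require Import all_boot all_order all_algebra.
From mathcomp Require Import boolp.
Import GRing.Theory.

Set Implicit Arguments.
Unset Strict Implicit.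
Unset Printing Implicit Defensive.

Local Open Scope ring_scope.

(** On a weight module [x] shifts weights by [chi], so a weight module is a
    module over [k[x]] graded by characters, [x] having degree [chi]. The
    theorem is the graded form of the classification of finitely generated
    torsion modules over [k[x]]: such a module is a sum of cyclic modules whose
    annihilators are powers of graded primes. The graded primes are [x] and the
    [f(x^s)] with [f] in Irr; the modules [V_t(lambda)] and [V(sigma, f^t)] are
    the corresponding cyclic modules, with generator [m_0].

    The key fact is [reach_socle]. If [v] is a weight vector with annihilator
    the [t]-th power [P] of a graded prime, then every nonzero submodule of
    [H v] contains the vector [u0] obtained by applying the [t-1]-st power of
    that prime to [v]. Elements of [H] that separate the weights
    ([weight_projector]) reduce this to the fact that [k[y]/(f^t)] is a chain
    ring. Three consequences follow. [H v] is indecomposable, since two nonzero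
    summands would both contain [u0] ([cyclic_indecomposable]). Its annihilator
    in [H] depends on [P] and the weight of [v] alone, so these data determine
    [H v] ([cyclic_isomorphic]). Conversely the module determines [P], the class
    of the weight modulo [chi], and for [P = x^t] the weight itself
    ([cyclic_unique]); for [f <> 'X] the vectors [x^i v] are generators too, so
    the weight can be moved inside its class ([cyclic_shift]).

    It remains to see that an indecomposable [M] is cyclic of this kind. As
    [x^s] is central, coprime factors of an annihilating polynomial of [x^s]
    split [M]; hence [M] is killed by a power of one graded prime
    ([indecomposable_primary]). Take the least such power [P], and a weight
    vector [v] on which the previous power does not vanish. A functional [phi]
    that transforms [G] by a character, and does not vanish on [u0], gives the
    submodule [C] of the [w] with [phi (H w) = 0]. It does not contain [u0], so
    it meets [H v] trivially, and it is defined by [\deg P = \dim (H v)]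
    equations, so [M] is the direct sum of [H v] and [C]; therefore [C = 0]
    ([indecomposable_cyclic]). *)

(** * Polynomials over a field *)

Section Polynomials.
Variable k : fieldType.
Implicit Types p q f : {poly k}.

(** A nonconstant divisor of least degree, made monic. *)
Lemma exists_irreducible_factor p : (1 < size p)%N ->
  exists f, [/\ f \is monic, irreducible_poly f & f %| p].
Proof.
move=> p_gt1.
pose Q n := `[< exists d : {poly k}, [/\ size d = n, (1 < n)%N & d %| p] >].
have exQ : exists n, Q n by exists (size p); apply/asboolP; exists p.
case: (ex_minnP exQ) => n /asboolP[d [szd n_gt1 dp]] min_n.
have d_neq0 : d != 0 by rewrite -size_poly_eq0 szd; case: n n_gt1 {szd min_n}.
have lc : lead_coef d != 0 by rewrite lead_coef_eq0.
have eqd : (lead_coef d)^-1 *: d %= d by rewrite eqp_scale ?invr_eq0.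
exists ((lead_coef d)^-1 *: d); split; last by rewrite (eqp_dvdl _ eqd).
  by rewrite monicE lead_coefZ mulVf.
split=> [|q q_neq1 qd]; first by rewrite (eqp_size eqd) szd.
rewrite (eqp_dvdr _ eqd) in qd.
rewrite (eqp_rtrans eqd).
have q_gt1 : (1 < size q)%N.
  have: (0 < size q)%N by rewrite lt0n size_poly_eq0 (dvdpN0 qd).
  by case: (size q) q_neq1 => [|[]].
rewrite -(dvdp_size_eqp qd) eqn_leq (dvdp_leq d_neq0 qd) /= szd.
by apply: min_n; apply/asboolP; exists q; rewrite (dvdp_trans qd dp).
Qed.

Lemma irreducible_power_split f p : irreducible_poly f -> p != 0 ->
  exists t q, p = f ^+ t * q /\ coprimep f q.
Proof.
move=> irr_f; have [n] := ubnP (size p); elim: n p => // n IHn p le_p p_neq0.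
have [fp|nfp] := boolP (f %| p); last first.
  by exists 0%N, p; rewrite expr0 mul1r irreducible_poly_coprime.
have f_neq0 := irredp_neq0 irr_f.
have def_p := divpK fp; set r := p %/ f in def_p.
have r_neq0 : r != 0 by apply: contraNneq p_neq0 => r0; rewrite -def_p r0 mul0r.
have [|t [q [def_r cfq]]] := IHn r _ r_neq0.
  apply: (@leq_trans (size p)) => //.
  rewrite size_divp // ltn_subrL size_poly_gt0 p_neq0 andbT.
  by case: irr_f => + _; case: (size f) => [|[]].
by exists t.+1, q; rewrite -def_p def_r mulrC exprS mulrA.
Qed.

(** Modulo [f ^+ t] every nonzero ideal contains [f ^+ t.-1]: the quotient is
    a chain ring. *)
Lemma irreducible_power_bezout f t q : irreducible_poly f ->
  ~~ (f ^+ t %| q) -> exists a b, a * q + b * f ^+ t = f ^+ t.-1.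
Proof.
move=> irr_f nfq.
have q_neq0 : q != 0 by apply: contraNneq nfq => ->; rewrite dvdp0.
have [j [r [def_q cfr]]] := irreducible_power_split irr_f q_neq0.
have lt_jt : (j < t)%N.
  rewrite ltnNge; apply: contra nfq => le_tj.
  by rewrite def_q dvdp_mulr // dvdp_exp2l.
have: coprimep r (f ^+ (t - j)) by rewrite coprimep_expr // coprimep_sym.
case/Bezout_eq1_coprimepP => -[a b] /= /(congr1 ( *%R (f ^+ t.-1))).
rewrite mulr1 => <-; exists (f ^+ (t.-1 - j) * a), (f ^+ (t.-1 - j) * b).
set m := (t.-1 - j)%N; have -> : t.-1 = (m + j)%N.
  by rewrite subnK // -ltnS prednK // (leq_trans _ lt_jt).
have {1}-> : t = (j + (t - j))%N by rewrite subnKC // ltnW.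
by rewrite def_q !exprD mulrDr; congr (_ + _); rewrite [LHS]mulrACA.
Qed.

Lemma irreducible_power_inj f g t u : in_Irr f -> in_Irr g ->
  (0 < t)%N -> f ^+ t = g ^+ u -> f = g /\ t = u.
Proof.
move=> [mf irr_f _] [mg irr_g _] t_gt0 eq_fg.
have fg : f %| g.
  have: f %| g ^+ u by rewrite -eq_fg dvdp_exp.
  apply: contraLR; rewrite -irreducible_poly_coprime // => cfg.
  by rewrite -irreducible_poly_coprime // coprimep_expr.
have eqf : f = g.
  apply/eqP; rewrite -eqp_monic //; apply: irr_g.2 => //.
  by case: irr_f => + _; case: (size f) => [|[]].
split=> //; move/(congr1 (fun p : {poly k} => (size p).-1)): eq_fg.
rewrite eqf !size_exp => /eqP; rewrite eqn_mul2l => /orP[|/eqP//].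
by case: irr_g => + _; case: (size g) => [|[]].
Qed.

(** Sorting the monomials of [q] by their degree modulo [e]. *)
Lemma residue_decomposition e q : (0 < e)%N ->
  exists qs : 'I_e -> {poly k}, q = \sum_(i < e) 'X^i * (qs i \Po 'X^e).
Proof.
move=> e_gt0; rewrite -[q]coefK poly_def.
elim/big_ind: _ => [|_ _ [p1 ->] [p2 ->]|i _].
- by exists (fun=> 0); rewrite big1 // => i _; rewrite comp_poly0 mulr0.
- exists (fun i => p1 i + p2 i); rewrite -big_split; apply: eq_bigr => i _ /=.
  by rewrite comp_polyD mulrDr.
pose r := Ordinal (ltn_pmod i e_gt0).
exists (fun j => if j == r then q`_i *: 'X^(i %/ e) else 0).
rewrite (bigD1 r) //= eqxx big1 => [|j /negPf->]; last first.
  by rewrite comp_poly0 mulr0.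
rewrite addr0 comp_polyZ -scalerAr rmorphXn /= comp_polyX -exprM -exprD.
by rewrite mulnC addnC -divn_eq.
Qed.

Lemma irreducible_polyX : irreducible_poly ('X : {poly k}).
Proof. by rewrite -[X in irreducible_poly X]subr0; apply: irredp_XsubC. Qed.

Lemma comp_polyXn_inj e : (0 < e)%N ->
  injective (fun p : {poly k} => p \Po 'X^e).
Proof.
move=> e_gt0 p q /= eq_pq; apply/polyP=> i.
move/polyP/(_ (i * e)%N): eq_pq.
by rewrite !coef_comp_poly_Xn // dvdn_mull // mulnK.
Qed.

End Polynomials.

(** * Weight vectors *)

(** The subalgebra [k[x]]; the constant is locked because unification would
    otherwise unfold the evaluation of polynomials. *)
HB.lock Definition hpoly (G : groupType) (k : fieldType) (chi : character G k)
  (q : {poly k}) : hopf_ore chi := horner_alg (hx chi) q.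

Section WeightVectors.
Variables (G : groupType) (k : fieldType) (chi : character G k).
Local Notation H := (hopf_ore chi).
Local Notation hmodType := (lmodType (hopf_ore chi)).
Local Notation px := (hpoly chi).
Implicit Types (M : hmodType) (c d : k) (h : H) (lambda mu : character G k).
Implicit Types (p q : {poly k}) (L : seq (character G k)).

Lemma char_mulC lambda mu : (lambda * mu)%g = (mu * lambda)%g.
Proof. by apply: charP => g; rewrite !char_mulE mulrC. Qed.

Lemma kscale_h M c h (v : M) : kscale c (h *: v) = (c *: h) *: v.
Proof. by rewrite /kscale scalerA mulr_algl. Qed.

Lemma h_kscale M c h (v : M) : h *: kscale c v = kscale c (h *: v).
Proof. by rewrite kscale_h /kscale scalerA mulr_algr. Qed.

Lemma kscaleA M c d (v : M) : kscale c (kscale d v) = kscale (c * d) v.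
Proof. by rewrite /kscale scalerA -scalerAl mul1r scalerA. Qed.

Lemma kscale1 M (v : M) : kscale 1 v = v.
Proof. by rewrite /kscale !scale1r. Qed.

Lemma kscale0l M (v : M) : kscale 0 v = 0.
Proof. by rewrite /kscale !scale0r. Qed.

Lemma kscale0r M c : kscale c (0 : M) = 0.
Proof. exact: scaler0. Qed.

Lemma kscaleDl M c d (v : M) : kscale (c + d) v = kscale c v + kscale d v.
Proof. by rewrite /kscale !scalerDl. Qed.

Lemma kscaleNl M c (v : M) : kscale (- c) v = - kscale c v.
Proof. by rewrite /kscale !scaleNr. Qed.

Lemma kscaleDr M c (v w : M) : kscale c (v + w) = kscale c v + kscale c w.
Proof. exact: scalerDr. Qed.

Lemma kscaleNr M c (v : M) : kscale c (- v) = - kscale c v.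
Proof. exact: scalerN. Qed.

Lemma kscale_sumr M c (I : Type) (r : seq I) (P : pred I) (F : I -> M) :
  kscale c (\sum_(i <- r | P i) F i) = \sum_(i <- r | P i) kscale c (F i).
Proof. exact: scaler_sumr. Qed.

Lemma kscale_suml M (v : M) (I : Type) (r : seq I) (P : pred I) (F : I -> k) :
  kscale (\sum_(i <- r | P i) F i) v = \sum_(i <- r | P i) kscale (F i) v.
Proof.
exact: (big_morph (fun c => kscale c v) (fun c d => kscaleDl c d v)
  (kscale0l v)).
Qed.

Lemma kscale_eq0 M c (v : M) : c != 0 -> kscale c v = 0 -> v = 0.
Proof.
by move=> c0 cv; rewrite -[v]kscale1 -(mulVf c0) -kscaleA cv kscale0r.
Qed.

Lemma weight_space0 M lambda : weight_space lambda (0 : M).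
Proof. by move=> g; rewrite scaler0 kscale0r. Qed.

Lemma weight_spaceD M lambda (v w : M) :
  weight_space lambda v -> weight_space lambda w -> weight_space lambda (v + w).
Proof. by move=> hv hw g; rewrite scalerDr hv hw kscaleDr. Qed.

Lemma weight_space_kscale M lambda c (v : M) :
  weight_space lambda v -> weight_space lambda (kscale c v).
Proof. by move=> hv g; rewrite h_kscale hv !kscaleA mulrC. Qed.

Lemma weight_space_sum M lambda (I : Type) (r : seq I) (P : pred I)
    (F : I -> M) :
  (forall i, P i -> weight_space lambda (F i)) ->
  weight_space lambda (\sum_(i <- r | P i) F i).
Proof.
move=> hF; elim/big_ind: _ => //; first exact: weight_space0.
exact: weight_spaceD.
Qed.

Lemma hgrp_hx g : hgrp chi g * hx chi = chi g *: (hx chi * hgrp chi g).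
Proof. by rewrite hx_hgrp scalerA char_invE mulfV ?char_neq0 // scale1r. Qed.

Lemma weight_space_x M lambda (v : M) : weight_space lambda v ->
  weight_space (chi * lambda)%g (hx chi *: v).
Proof.
move=> hv g; rewrite scalerA hgrp_hx -kscale_h -scalerA hv h_kscale kscaleA.
by rewrite char_mulE.
Qed.

Lemma weight_space_xn M lambda (v : M) i : weight_space lambda v ->
  weight_space (chi ^+ i * lambda)%g (hx chi ^+ i *: v).
Proof.
move=> hv; elim: i => [|i IHi]; first by rewrite scale1r mul1g.
by rewrite exprS -scalerA expgS -mulgA; apply: weight_space_x.
Qed.

(** The product over [mu] in [L], [mu != lambda], of the elements
    [(lambda g - mu g)^-1 (g - mu g)], where [g] separates [lambda] from [mu]:
    an element of the group algebra, independent of the module. *)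
Lemma weight_projector lambda L : exists h : H, forall M (v : M) mu,
  weight_space mu v ->
  (mu = lambda -> h *: v = v) /\ (mu \in L -> mu <> lambda -> h *: v = 0).
Proof.
elim: L => [|nu L [h hP]].
  by exists 1 => M v mu hv; split=> // _; rewrite scale1r.
have [->|/eqP ne_nu] := eqVneq nu lambda.
  exists h => M v mu hv; have [h1 h2] := hP M v mu hv; split=> //.
  by rewrite inE => /orP[/eqP|].
have [g ne_g] : exists g, lambda g != nu g.
  apply: contra_notP ne_nu => no_g; apply: charP => g.
  by apply: contra_notP no_g => ne_g; exists g; apply/eqP => /esym.
pose h' : H := (lambda g - nu g)^-1 *: (hgrp chi g - (nu g)%:A).
have h'E M (v : M) mu : weight_space mu v ->
    h' *: v = kscale ((lambda g - nu g)^-1 * (mu g - nu g)) v.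
  by move=> hv; rewrite -kscale_h scalerBl hv -kscaleA kscaleDl kscaleNl.
exists (h * h') => M v mu hv; rewrite -!scalerA (h'E _ _ _ hv).
have [h1 h2] := hP M v mu hv; split=> [def_mu|].
  by rewrite def_mu mulVf ?subr_eq0 // kscale1 h1.
rewrite inE => /orP[/eqP->|mu_L] ne_mu.
  by rewrite subrr mulr0 kscale0l scaler0.
by rewrite h_kscale h2 // kscale0r.
Qed.

Lemma weight_space_inj M lambda mu (v : M) : v <> 0 ->
  weight_space lambda v -> weight_space mu v -> lambda = mu.
Proof.
move=> v_neq0 hl hm; apply: charP => g; apply/eqP; rewrite -subr_eq0.
apply: contra_notT v_neq0 => /kscale_eq0; apply.
by rewrite kscaleDl kscaleNl -hl -hm subrr.
Qed.

(** Membership in the span of the weight vectors already makes a weight module: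
    the sum of the weight spaces is always direct. *)
Lemma weight_module_span M : (forall v : M, exists (I : finType)
    (l : I -> character G k) (w : I -> M),
    (forall i, weight_space (l i) (w i)) /\ v = \sum_i w i) -> weight_module M.
Proof.
move=> spanM; split=> [v|L w uL wL sum0 lambda lambdaL]; last first.
  have [h hP] := weight_projector lambda L.
  move/(congr1 ( *:%R h)): sum0.
  rewrite scaler0 scaler_sumr (bigD1_seq lambda) //=.
  rewrite (hP _ _ _ (wL _ lambdaL)).1 // big1_seq ?addr0 //.
  move=> mu /andP[/eqP ne mu_L].
  by rewrite (hP _ _ _ (wL _ mu_L)).2.
have [I [l [w [lw ->]]]] := spanM v.
exists (undup [seq l i | i <- enum I]).
exists (fun lambda => \sum_(i | l i == lambda) w i).
split=> [|lambda _|]; first exact: undup_uniq.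
  by apply: weight_space_sum => i /eqP <-.
rewrite (exchange_big_dep xpredT) //=; apply: eq_bigr => i _.
rewrite (eq_bigl (pred1 (l i))) => [|mu]; last by rewrite eq_sym.
rewrite -big_filter filter_pred1_uniq ?undup_uniq ?big_seq1 //.
by rewrite mem_undup map_f ?mem_enum.
Qed.

Lemma px0 : px 0 = 0.
Proof. by rewrite hpoly.unlock rmorph0. Qed.

Lemma pxC c : px c%:P = c%:A.
Proof. by rewrite hpoly.unlock horner_algC. Qed.

Lemma pxD p q : px (p + q) = px p + px q.
Proof. by rewrite hpoly.unlock rmorphD. Qed.

Lemma pxM p q : px (p * q) = px p * px q.
Proof. by rewrite hpoly.unlock rmorphM. Qed.

Lemma pxZ c q : px (c *: q) = c *: px q.
Proof. by rewrite -mul_polyC pxM pxC mulr_algl. Qed.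

Lemma pxX : px 'X = hx chi.
Proof. by rewrite hpoly.unlock horner_algX. Qed.

Lemma pxXn i : px 'X^i = hx chi ^+ i.
Proof. by rewrite hpoly.unlock rmorphXn /= horner_algX. Qed.

Lemma px_sum (I : Type) (r : seq I) (P : pred I) (F : I -> {poly k}) :
  px (\sum_(i <- r | P i) F i) = \sum_(i <- r | P i) px (F i).
Proof. exact: (big_morph px pxD px0). Qed.

Lemma pxE q : px q = \sum_(i < size q) q`_i *: hx chi ^+ i.
Proof.
rewrite -[in LHS](coefK q) poly_def px_sum; apply: eq_bigr => i _.
by rewrite pxZ pxXn.
Qed.

Lemma pxE_scale M q (v : M) :
  px q *: v = \sum_(i < size q) kscale q`_i (hx chi ^+ i *: v).
Proof.
by rewrite pxE scaler_suml; apply: eq_bigr => i _; rewrite kscale_h.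
Qed.

Lemma pxE_widen M n q (v : M) : (size q <= n)%N ->
  px q *: v = \sum_(i < n) kscale q`_i (hx chi ^+ i *: v).
Proof.
move=> le_qn; rewrite pxE_scale.
rewrite (big_ord_widen _ (fun i => kscale q`_i (hx chi ^+ i *: v)) le_qn).
rewrite [LHS]big_mkcond; apply: eq_bigr => j _.
by case: ltnP => // le_qj; rewrite nth_default ?kscale0l.
Qed.

Lemma px_scaleM M p q (v : M) : px (p * q) *: v = px p *: (px q *: v).
Proof. by rewrite pxM scalerA. Qed.

Lemma px_scaleD M p q (v : M) : px (p + q) *: v = px p *: v + px q *: v.
Proof. by rewrite pxD scalerDl. Qed.

(** On a vector of weight [lambda] the element [g x^i] acts as a scalar multiple
    of [x^i], and the scalar depends on [lambda] alone. *)
Lemma weight_px lambda h : exists q, forall M (v : M),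
  weight_space lambda v -> h *: v = px q *: v.
Proof.
elim/hb_ind: h => [|h h' [q hq] [q' hq']|c h [q hq]|[g i]].
- by exists 0 => M v _; rewrite px0.
- by exists (q + q') => M v hv; rewrite pxD !scalerDl hq ?hq'.
- by exists (c *: q) => M v hv; rewrite pxZ -!kscale_h hq.
exists ((chi ^+ i * lambda)%g g *: 'X^i) => M v hv.
rewrite pxZ pxXn hb_grpx -scalerA -kscale_h.
exact: weight_space_xn.
Qed.

Lemma hgrp_hxn g i : hgrp chi g * hx chi ^+ i
  = (chi ^+ i)%g g *: (hx chi ^+ i * hgrp chi g).
Proof.
elim: i => [|i IHi]; first by rewrite mulr1 mul1r scale1r.
rewrite exprSr mulrA IHi -scalerAl -[X in _ *: X]mulrA hgrp_hx -scalerAr scalerA.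
by rewrite expgSr char_mulE; congr (_ *: _); apply: mulrA.
Qed.

(** As [chi ^+ s = 1], the element [x^s] commutes with [G], hence is central. *)
Lemma central_px_comp s q h : (chi ^+ s = 1)%g ->
  h * px (q \Po 'X^s) = px (q \Po 'X^s) * h.
Proof.
move=> chis; suff xsC h' : h' * hx chi ^+ s = hx chi ^+ s * h'.
  elim/poly_ind: q => [|q c IHq]; first by rewrite comp_poly0 px0 mulr0 mul0r.
  rewrite comp_poly_MXaddC pxD pxM pxXn pxC.
  by rewrite mulrDr mulrDl mulrA IHq -!mulrA xsC mulr_algr mulr_algl.
elim/hb_ind: h' => [|p p' IH IH'|c p IH|[g i]].
- by rewrite mulr0 mul0r.
- by rewrite mulrDl mulrDr IH IH'.
- by rewrite -scalerAl -scalerAr IH.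
rewrite hb_grpx -mulrA -exprD addnC exprD !mulrA; congr (_ * _).
by rewrite hgrp_hxn chis scale1r.
Qed.

End WeightVectors.

(** * Submodules, isomorphisms and direct sums *)

Section Submodules.
Variables (R : nzRingType) (M : lmodType R).

Record submodule : Type := Submodule {
  sub_mem :> M -> Prop;
  sub_mem0 : sub_mem 0;
  sub_memD : forall v w, sub_mem v -> sub_mem w -> sub_mem (v + w);
  sub_memZ : forall h v, sub_mem v -> sub_mem (h *: v)
}.

Variable U : submodule.

Definition sub_pred : {pred M} := fun v => `[< U v >].

Fact sub_pred_closed : submod_closed sub_pred.
Proof.
split=> [|h v w /asboolP hv /asboolP hw]; apply/asboolP.
  exact: sub_mem0.
by apply: sub_memD => //; apply: sub_memZ.
Qed.

HB.instance Definition _ := GRing.isSubmodClosed.Build R M sub_pred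
  sub_pred_closed.

Definition sub_type : Type := {v : M | v \in sub_pred}.

HB.instance Definition _ := [isSub of sub_type for @sval _ _].
HB.instance Definition _ := [Choice of sub_type by <:].
HB.instance Definition _ := [SubChoice_isSubLmodule of sub_type by <:].

Definition sub_module : lmodType R := sub_type.

End Submodules.

Section SubmoduleConstructions.
Variables (R : nzRingType) (M : lmodType R).

Definition cyclic_submodule (v : M) : submodule M.
Proof.
apply: (@Submodule R M (fun w => exists h, w = h *: v)).
- by exists 0; rewrite scale0r.
- by move=> _ _ [h ->] [h' ->]; exists (h + h'); rewrite scalerDl.
by move=> h' _ [h ->]; exists (h' * h); rewrite scalerA.
Defined.

Definition central_kernel (z : R) (zC : forall h, h * z = z * h) : submodule M.
Proof.
apply: (@Submodule R M (fun v => z *: v = 0)); first exact: scaler0.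
  by move=> v w zv zw; rewrite scalerDr zv zw addr0.
by move=> h v zv; rewrite scalerA -zC -scalerA zv scaler0.
Defined.

(** The largest submodule contained in the kernel of [phi]. *)
Definition kernel_core (A : zmodType) (phi : M -> A)
  (phiD : {morph phi : v w / v + w}) : submodule M.
Proof.
apply: (@Submodule R M (fun w => forall h : R, phi (h *: w) = 0)).
- by move=> h; rewrite scaler0; apply: (addrI (phi 0)); rewrite -phiD !addr0.
- by move=> w w' hw hw' h; rewrite scalerDr phiD hw hw' addr0.
by move=> h' w hw h; rewrite scalerA.
Defined.

End SubmoduleConstructions.

Lemma injective_surjective_bijective (A : Type) (B : Type) (f : A -> B) :
  injective f -> (forall y, exists x, f x = y) -> bijective f.
Proof.
move=> f_inj f_surj; pose g y := sval (cid (f_surj y)).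
have fg : cancel g f by move=> y; rewrite /g; case: cid.
by exists g => // x; apply: f_inj; rewrite fg.
Qed.

Section Decompositions.
Variables (G : groupType) (k : fieldType) (chi : character G k).
Local Notation H := (hopf_ore chi).
Local Notation hmodType := (lmodType (hopf_ore chi)).
Implicit Types (M N : hmodType) (h : H).

Lemma linear_isomorphic M N (f : M -> N) :
  linear f -> bijective f -> isomorphic M N.
Proof.
move=> f_lin f_bij.
pose fL := GRing.isLinear.Build H M N *:%R f f_lin.
pose F : {linear M -> N} := HB.pack f fL.
by exists F.
Qed.

Lemma isomorphic_sym M N : isomorphic M N -> isomorphic N M.
Proof.
case=> f [g fK gK]; apply: (@linear_isomorphic _ _ g); last by exists f.
exact: can2_linear fK gK.
Qed.

Lemma sub_weight_space M (U : submodule M) lambda (u : sub_module U) :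
  weight_space lambda (\val u) -> weight_space lambda u.
Proof. by move=> hu g; apply: val_inj; apply: hu. Qed.

(** The weight components of a vector are its images under elements of the
    algebra, so they stay in any submodule containing it. *)
Lemma sub_weight_module M (U : submodule M) :
  weight_module M -> weight_module (sub_module U).
Proof.
move=> wM; apply: weight_module_span => u.
have [/(_ (\val u)) [L [w [uL wL def_u]]] _] := wM.
have Uw lambda : lambda \in L -> U (w lambda).
  move=> lambdaL; have [h hP] := weight_projector chi lambda L.
  suff <- : h *: \val u = w lambda.
    by apply: sub_memZ; apply/asboolP; apply: (valP u).
  rewrite def_u scaler_sumr (bigD1_seq lambda) //=.
  rewrite (hP _ _ _ (wL _ lambdaL)).1 // big1_seq ?addr0 //.
  by move=> mu /andP[/eqP ne mu_L]; rewrite (hP _ _ _ (wL _ mu_L)).2.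
exists 'I_(size L), (fun i : 'I_(size L) => nth 1%g L i).
exists (fun i : 'I_(size L) => insubd (0 : sub_module U) (w (nth 1%g L i))).
have val_w (i : 'I_(size L)) :
    \val (insubd (0 : sub_module U) (w (nth 1%g L i))) = w (nth 1%g L i).
  by rewrite insubdK //; apply/asboolP/Uw/mem_nth.
split=> [i|].
  by apply: sub_weight_space; rewrite val_w; apply/wL/mem_nth.
apply: val_inj; rewrite raddf_sum def_u (big_nth 1%g) big_mkord.
by apply: eq_bigr => i _; exact: (esym (val_w i)).
Qed.

(** Internal form of indecomposability: the summands of the definition are
    abstract modules, here they are complementary submodules. *)
Lemma indecomposable_split M (U W : submodule M) :
  indecomposable_weight_module M ->
  (forall v, U v -> W v -> v = 0) ->
  (forall v, exists u w, [/\ U u, W w & v = u + w]) ->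
  (forall v, U v -> v = 0) \/ (forall v, W v -> v = 0).
Proof.
case=> wM _ indec UW0 UWM.
pose f (z : (sub_module U * sub_module W)%type) : M := \val z.1 + \val z.2.
have f_lin : linear f.
  by move=> h y z; rewrite /f /= scalerDr addrACA.
have mem_val (V : submodule M) (v : sub_module V) : V (\val v).
  by apply/asboolP; apply: (valP v).
have f_ker z : f z = 0 -> z = 0.
  case: z => u w /eqP; rewrite addr_eq0 => /eqP uw.
  rewrite -[(u, w).1]/u -[(u, w).2]/w in uw.
  have u0 : \val u = 0.
    apply: UW0; first exact: mem_val.
    by rewrite uw -scaleN1r; apply/sub_memZ/mem_val.
  have w0 : \val w = 0 by apply/eqP; rewrite -oppr_eq0 -uw u0.
  by congr (_, _); apply: val_inj.
have f_iso : isomorphic (sub_module U * sub_module W)%type M.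
  apply: (linear_isomorphic f_lin); apply: injective_surjective_bijective.
    move=> y z fyz; apply/eqP; rewrite -subr_eq0; apply/eqP/f_ker.
    by rewrite addrC -scaleN1r f_lin fyz scaleN1r addNr.
  move=> v; have [u [w [Uu Ww ->]]] := UWM v.
  have Uu' : u \in sub_pred U by apply/asboolP.
  have Ww' : w \in sub_pred W by apply/asboolP.
  by exists (exist _ u Uu', exist _ w Ww').
have [||A0|B0] := indec _ _ _ _ (isomorphic_sym f_iso).
- exact: sub_weight_module.
- exact: sub_weight_module.
- left=> v Uv; have Uv' : v \in sub_pred U by apply/asboolP.
  exact: (congr1 val (A0 (exist _ v Uv'))).
- right=> v Wv; have Wv' : v \in sub_pred W by apply/asboolP.
  exact: (congr1 val (B0 (exist _ v Wv'))).
Qed.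

End Decompositions.

(** * Cyclic weight modules *)

Section CyclicModules.
Variables (G : groupType) (k : fieldType) (chi : character G k).
Variables (s : nat) (hs : has_order chi s).
Local Notation H := (hopf_ore chi).
Local Notation hmodType := (lmodType (hopf_ore chi)).
Local Notation px := (hpoly chi).
Implicit Types (M N : hmodType) (h : H) (lambda mu : character G k).
Implicit Types (f g q : {poly k}) (t u : nat).

Definition monic_irreducible f : Prop := f \is monic /\ irreducible_poly f.

(** The primes of [k[x]], graded by the cyclic group generated by [chi], are
    ['X] and the [f(x^s)] with [f] in Irr; [gprime f t] is the [t]-th power of
    the one attached to [f]. *)
Definition step f : nat := if f == 'X then 1%N else s.
Definition gprime f t : {poly k} := (f ^+ t) \Po 'X^(step f).

Lemma step_gt0 f : (0 < step f)%N.
Proof. by rewrite /step; case: ifP => // _; case: hs. Qed.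

Lemma gprimeX t : gprime 'X t = 'X^t.
Proof. by rewrite /gprime /step eqxx expr1 comp_polyXr. Qed.

Lemma gprime_monic f t : f \is monic -> gprime f t \is monic.
Proof.
move=> mf; rewrite monicE lead_coef_comp; last by rewrite size_polyXn ltnS step_gt0.
by rewrite lead_coefXn expr1n mulr1 -monicE monic_exp.
Qed.

Lemma has_order_inj i j : (i < s)%N -> (j < s)%N ->
  (chi ^+ i = chi ^+ j)%g -> i = j.
Proof.
wlog le_ij : i j / (i <= j)%N.
  by move=> W; case/orP: (leq_total i j) => /W // W' ? ? /esym /W' ->.
move=> _ lt_js; have [_ _ min_s] := hs.
rewrite -(subnK le_ij) addnC expgnDr -{1}[(chi ^+ i)%g]mulg1.
move/mulgI => /esym chi_ij.
case: (posnP (j - i)) => [->|ij_gt0]; first by rewrite addn0.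
by case: (min_s (j - i)%N) => //; rewrite ij_gt0 (leq_ltn_trans (leq_subr _ _)).
Qed.

Lemma in_Irr_coprimeX f : in_Irr f -> coprimep f 'X.
Proof.
case=> mf irr_f f_neqX; rewrite coprimep_sym irreducible_poly_coprime; last first.
  exact: irreducible_polyX.
apply/negP => Xf; apply: f_neqX; apply/eqP.
rewrite -eqp_monic ?monicX // eqp_sym; apply: irr_f.2 => //.
by rewrite size_polyX.
Qed.

Lemma monic_irreducible_cases f : monic_irreducible f -> f = 'X \/ in_Irr f.
Proof. by case=> mf irr_f; case: (eqVneq f 'X) => [|/eqP]; [left|right]. Qed.

Lemma step_in_Irr f : in_Irr f -> step f = s.
Proof. by case=> _ _ /eqP/negPf f_neqX; rewrite /step f_neqX. Qed.

(** The two kinds of graded primes are told apart by their value at 0. *)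
Lemma gprime_inj f g t u : monic_irreducible f -> monic_irreducible g ->
  (0 < t)%N -> (0 < u)%N -> gprime f t = gprime g u -> f = g /\ t = u.
Proof.
have s_gt0 : (0 < s)%N by case: hs.
have nX g' u' t' : in_Irr g' -> (0 < t')%N -> gprime g' u' <> 'X^t'.
  move=> irr_g t_gt0 /(congr1 (fun p => p.[0])).
  rewrite /gprime step_in_Irr // horner_comp !hornerXn !expr0n !gtn_eqF // => /eqP.
  have /coprimep_root/(_ (_ : root 'X 0)) : coprimep 'X g'.
    by rewrite coprimep_sym in_Irr_coprimeX.
  by rewrite rootX => /(_ (eqxx _))/negPf g0; rewrite horner_exp expf_eq0 g0 andbF.
move=> /monic_irreducible_cases[->|irr_f] /monic_irreducible_cases[->|irr_g]
  t_gt0 u_gt0.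
- rewrite !gprimeX => /(congr1 (fun p : {poly k} => size p)).
  by rewrite /= !size_polyXn => -[->]; split.
- by rewrite gprimeX => /esym /(nX _ _ _ irr_g t_gt0).
- by rewrite gprimeX => /(nX _ _ _ irr_f u_gt0).
rewrite /gprime !step_in_Irr // => /(comp_polyXn_inj s_gt0).
exact: irreducible_power_inj.
Qed.

Lemma weight_space_px_comp M lambda (v : M) q :
  weight_space lambda v -> weight_space lambda (px (q \Po 'X^s) *: v).
Proof.
move=> hv g; have [_ chis _] := hs.
by rewrite scalerA central_px_comp // -scalerA hv h_kscale.
Qed.

(** For [f = 'X] the quotient of [k[x]] by [x^t] is a chain ring. For [f <> 'X]
    the quotient by [f(x^s)^t] need not be one, since [f(x^s)] may factor. One
    first projects [q v] on a nonzero weight component [x^i q_i(x^s) v]; there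
    multiplication by [x^(s - i)] gives a polynomial in [y = x^s], still not
    divisible by [f^t] as [f] is prime to [y], and [k[y]/(f^t)] is a chain
    ring. *)
Lemma reach_socle M (v : M) lambda f t q :
  monic_irreducible f -> weight_space lambda v -> px (gprime f t) *: v = 0 ->
  ~~ (gprime f t %| q) -> exists h, h *: (px q *: v) = px (gprime f t.-1) *: v.
Proof.
move=> mi_f hv fv0; have irr_f := mi_f.2.
have via_bezout a b r : a * r + b * gprime f t = gprime f t.-1 ->
    px a *: (px r *: v) = px (gprime f t.-1) *: v.
  by move=> <-; rewrite px_scaleD (px_scaleM a) (px_scaleM b) fv0 scaler0 addr0.
have [def_f|irrf] := monic_irreducible_cases mi_f.
  rewrite def_f gprimeX => /(irreducible_power_bezout (irreducible_polyX k))[a [b ab]].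
  by exists (px a); rewrite -def_f; apply: (via_bezout a b); rewrite def_f !gprimeX.
have [s_gt0 chis _] := hs.
have [qs def_q] := residue_decomposition q s_gt0.
rewrite {1}/gprime (step_in_Irr irrf) => nfq.
have [i nfi] : exists i, ~~ (f ^+ t %| qs i).
  apply/existsP; apply: contraR nfq; rewrite negb_exists => /forallP fq.
  rewrite def_q; apply: (big_ind (fun p => _ %| p)); [exact: dvdp0|exact: dvdp_add|].
  by move=> i _; rewrite dvdp_mull // dvdp_comp_poly // -[_ %| _]negbK fq.
pose L := [seq (chi ^+ val j * lambda)%g | j <- enum 'I_s].
have [h hP] := weight_projector chi (chi ^+ i * lambda)%g L.
have w_j (j : 'I_s) :
    weight_space (chi ^+ j * lambda)%g (px ('X^j * (qs j \Po 'X^s)) *: v).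
  rewrite px_scaleM pxXn; apply: weight_space_xn.
  exact: weight_space_px_comp.
have h_qv : h *: (px q *: v) = px ('X^i * (qs i \Po 'X^s)) *: v.
  rewrite {1}def_q px_sum scaler_suml scaler_sumr (bigD1 i) //=.
  rewrite (hP _ _ _ (w_j i)).1 // big1 ?addr0 // => j ne_ji.
  apply: (hP _ _ _ (w_j j)).2; first by apply/mapP; exists j; rewrite ?mem_enum.
  by move/mulIg/has_order_inj => eq_ji; case/eqP: ne_ji; apply/val_inj/eq_ji.
have nfXi : ~~ (f ^+ t %| 'X * qs i).
  by rewrite Gauss_dvdpr // coprimep_expl // in_Irr_coprimeX.
have [a [b ab]] := irreducible_power_bezout irr_f nfXi.
exists (px ((a \Po 'X^s) * 'X^(s - i)) * h).
rewrite -scalerA h_qv -px_scaleM.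
have -> : (a \Po 'X^s) * 'X^(s - i) * ('X^i * (qs i \Po 'X^s))
    = (a \Po 'X^s) * (('X * qs i) \Po 'X^s).
  by rewrite comp_polyM comp_polyX -mulrA (mulrA 'X^_ 'X^i) -exprD subnK 1?ltnW.
rewrite px_scaleM; apply: (via_bezout _ (b \Po 'X^s)).
by rewrite /gprime (step_in_Irr irrf) -!comp_polyM -comp_polyD ab.
Qed.

(** [M] is generated by [v], of weight [lambda], and [cyclic_socle] makes
    [gprime f t] the exact annihilator of [v] in [k[x]]. *)
Record cyclic_type M (v : M) lambda f t : Prop := CyclicType {
  cyclic_weight : weight_space lambda v;
  cyclic_ann : px (gprime f t) *: v = 0;
  cyclic_socle : px (gprime f t.-1) *: v <> 0;
  cyclic_gen : forall w : M, exists h, w = h *: v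
}.

Section OneCyclicModule.
Variables (M : hmodType) (v : M) (lambda : character G k).
Variables (f : {poly k}) (t : nat).
Hypotheses (mi_f : monic_irreducible f) (cyc : cyclic_type v lambda f t).

Lemma cyclic_px (w : M) : exists q, w = px q *: v.
Proof.
have [h ->] := cyclic_gen cyc w; have [q hq] := weight_px lambda h.
by exists q; apply/hq/(cyclic_weight cyc).
Qed.

Lemma cyclic_px_eq0 q : px q *: v = 0 <-> gprime f t %| q.
Proof.
split=> [qv0|/dvdpP[r ->]]; last first.
  by rewrite px_scaleM (cyclic_ann cyc) scaler0.
apply: contraT => nq; case: (cyclic_socle cyc).
have [h <-] := reach_socle mi_f (cyclic_weight cyc) (cyclic_ann cyc) nq.
by rewrite qv0 scaler0.
Qed.

Lemma cyclic_reach_socle (w : M) : w <> 0 ->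
  exists h, h *: w = px (gprime f t.-1) *: v.
Proof.
have [q ->] := cyclic_px w => qv_neq0.
apply: (reach_socle mi_f (cyclic_weight cyc) (cyclic_ann cyc)).
by apply/negP => /cyclic_px_eq0.
Qed.

Lemma cyclic_ann_all (w : M) : px (gprime f t) *: w = 0.
Proof.
have [q ->] := cyclic_px w.
by rewrite -px_scaleM mulrC px_scaleM (cyclic_ann cyc) scaler0.
Qed.

Lemma cyclic_gt0 : (0 < t)%N.
Proof.
by case: t (cyclic_ann cyc) (cyclic_socle cyc) => [|//] ->.
Qed.

Lemma cyclic_weight_module : weight_module M.
Proof.
apply: weight_module_span => w; have [q ->] := cyclic_px w.
exists 'I_(size q), (fun i : 'I__ => (chi ^+ i * lambda)%g).
exists (fun i : 'I__ => kscale q`_i (hx chi ^+ i *: v)); split; last exact: pxE_scale.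
by move=> i; apply/weight_space_kscale/weight_space_xn/(cyclic_weight cyc).
Qed.

(** Two nonzero submodules cannot meet trivially, since both contain the
    vector [gprime f t.-1 v]. *)
Lemma cyclic_indecomposable : indecomposable_weight_module M.
Proof.
split=> [|M0|A B _ _ [phi [psi phiK psiK]]]; first exact: cyclic_weight_module.
  by case: (cyclic_socle cyc); apply: M0.
set u0 := px (gprime f t.-1) *: v.
have reach (z : (A * B)%type) : z <> 0 -> exists h, h *: z = phi u0.
  move=> z_neq0; have [|h hz] := @cyclic_reach_socle (psi z).
    by move=> psiz; apply: z_neq0; rewrite -[z]psiK psiz linear0.
  by exists h; rewrite -[z]psiK -linearZ /= hz.
apply: contrapT => /not_orP[/existsNP[a a_neq0] /existsNP[b b_neq0]].
have [|h /(congr1 snd) /= ha] := reach (a, 0); first by case.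
have [|h' /(congr1 fst) /= hb] := reach (0, b); first by case.
case: (cyclic_socle cyc); rewrite -/u0 -[u0]phiK.
have -> : phi u0 = 0.
  by case: (phi u0) ha hb => c d /= <- <-; rewrite !scaler0.
by rewrite -[RHS]phiK linear0.
Qed.

End OneCyclicModule.

(** Whether [h v] vanishes depends on [h], [lambda] and [gprime f t] alone, so
    that [h v |-> h w] is well defined and injective. *)
Lemma cyclic_isomorphic M N (v : M) (w : N) lambda f t : monic_irreducible f ->
  cyclic_type v lambda f t -> cyclic_type w lambda f t -> isomorphic M N.
Proof.
move=> mi_f cv cw.
have ann h : h *: v = 0 <-> h *: w = 0.
  have [q hq] := weight_px lambda h.
  rewrite !hq; [|exact: cyclic_weight cw|exact: cyclic_weight cv].
  by rewrite (cyclic_px_eq0 mi_f cv) (cyclic_px_eq0 mi_f cw).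
have annB h h' : h *: v = h' *: v <-> h *: w = h' *: w.
  split=> /eqP; rewrite -subr_eq0 -scalerBl => /eqP/ann/eqP;
    by rewrite scalerBl subr_eq0 => /eqP.
pose phi (u : M) := sval (cid (cyclic_gen cv u)) *: w.
have phiE h : phi (h *: v) = h *: w.
  by rewrite /phi; case: cid => h' /= /annB ->.
apply: (@linear_isomorphic _ _ _ _ _ phi) => [h u u'|].
  have [[hu ->] [hu' ->]] := (cyclic_gen cv u, cyclic_gen cv u').
  by rewrite scalerA -scalerDl !phiE scalerDl scalerA.
apply: injective_surjective_bijective => [u u'|z].
  have [[hu ->] [hu' ->]] := (cyclic_gen cv u, cyclic_gen cv u').
  by rewrite !phiE => /annB.
by have [h ->] := cyclic_gen cw z; exists (h *: v).
Qed.

Lemma cyclic_transport M N (phi : {linear M -> N}) (v : M) lambda f t :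
  bijective phi -> cyclic_type v lambda f t -> cyclic_type (phi v) lambda f t.
Proof.
move=> bij_phi [wv v0 sv gv]; have [psi phiK psiK] := bij_phi.
split=> [g|||w]; rewrite -?linearZ /=.
- by rewrite wv /kscale linearZ.
- by rewrite v0 linear0.
- by move=> /(congr1 psi); rewrite phiK -[0](linear0 phi) phiK.
have [h def_w] := gv (psi w).
by exists h; rewrite -[w]psiK def_w linearZ.
Qed.

(** As [w] is a combination of the [x^j v], of weights [chi^j lambda], the
    projector to the weight [mu] would kill [w] if [mu] were none of these. *)
Lemma cyclic_weights M (v w : M) lambda mu f t : cyclic_type v lambda f t ->
  weight_space mu w -> w <> 0 -> exists j, mu = (chi ^+ j * lambda)%g.
Proof.
move=> cv hw; have [q def_w] := cyclic_px cv w.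
apply: contra_notP => no_j.
have [h hP] := weight_projector chi mu
  [seq (chi ^+ j * lambda)%g | j <- iota 0 (size q)].
rewrite -((hP _ _ _ hw).1 erefl) def_w pxE_scale scaler_sumr big1 // => i _.
rewrite h_kscale.
have hxi := weight_space_xn (nat_of_ord i) (cyclic_weight cv).
rewrite (hP _ _ _ hxi).2 ?kscale0r //.
  by apply/mapP; exists (val i); rewrite // mem_iota add0n ltn_ord.
by move=> eq_mu; apply: no_j; exists i.
Qed.

(** The graded prime power generates the annihilator of [M] in [k[x]]. If it is
    [x^t], write [w = q_0 v + x w']; then [x^(t-1) w = q_0 x^(t-1) v] is a
    nonzero vector of both weights [chi^(t-1) mu] and [chi^(t-1) lambda]. *)
Lemma cyclic_unique M (v w : M) lambda mu f g t u :
  monic_irreducible f -> monic_irreducible g ->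
  cyclic_type v lambda f t -> cyclic_type w mu g u ->
  [/\ f = g, t = u, exists j, mu = (chi ^+ j * lambda)%g
    & f = 'X -> lambda = mu].
Proof.
move=> mi_f mi_g cv cw.
have [def_g def_u] : f = g /\ t = u.
  apply: gprime_inj => //; [exact: cyclic_gt0 cv|exact: cyclic_gt0 cw|].
  apply/eqP; rewrite -eqp_monic; last exact: gprime_monic mi_g.1.
    apply/andP; split.
      by apply/(cyclic_px_eq0 mi_f cv)/(cyclic_ann_all cw).
    by apply/(cyclic_px_eq0 mi_g cw)/(cyclic_ann_all cv).
  exact: gprime_monic mi_f.1.
split=> //.
  apply: (cyclic_weights cv (cyclic_weight cw)) => w0.
  by apply: (cyclic_socle cw); rewrite w0 scaler0.
move=> f_X; rewrite -def_g -def_u f_X in cw; rewrite f_X in cv.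
have [q def_w] := cyclic_px cv w.
have xt0 : hx chi ^+ t *: v = 0 by rewrite -pxXn -gprimeX (cyclic_ann cv).
have xw : hx chi ^+ t.-1 *: w = kscale q`_0 (hx chi ^+ t.-1 *: v).
  have -> : w = kscale q`_0 v + hx chi *: (px (drop_poly 1 q) *: v).
    rewrite def_w; have {1}-> : q = (q`_0)%:P + 'X * drop_poly 1 q.
      rewrite -{1}(poly_take_drop 1 q) expr1 mulrC; congr (_ + _).
      by apply/polyP=> i; rewrite coef_take_poly coefC; case: i.
    by rewrite pxD pxM pxC pxX scalerDl scalerA.
  rewrite scalerDr h_kscale scalerA -exprSr (prednK (cyclic_gt0 cv)).
  by rewrite -[hx chi ^+ t]pxXn -px_scaleM mulrC px_scaleM pxXn xt0 scaler0 addr0.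
apply/esym/(@mulgI _ (chi ^+ t.-1)%g).
apply: (@weight_space_inj _ _ _ _ _ _ (hx chi ^+ t.-1 *: w)).
- by rewrite -pxXn -gprimeX; apply: (cyclic_socle cw).
- exact: weight_space_xn (cyclic_weight cw).
by rewrite xw; apply/weight_space_kscale/weight_space_xn/(cyclic_weight cv).
Qed.

End CyclicModules.

(** * The modules of the list are cyclic *)

Section ListedModules.
Variables (G : groupType) (k : fieldType) (chi : character G k).
Variables (s : nat) (hs : has_order chi s).
Local Notation px := (hpoly chi).
Implicit Types (lambda : character G k) (f : {poly k}).

Lemma size_gprime f t : f \is monic ->
  size (gprime s f t) = (((size f).-1 * t) * step s f).+1.
Proof.
move=> mf; rewrite -[LHS]prednK; last first.
  by rewrite size_poly_gt0 monic_neq0 // (gprime_monic hs).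
by rewrite size_comp_poly size_polyXn size_exp.
Qed.

Section ShiftedBasis.
Variables (n : nat) (M : lmodType (hopf_ore chi)) (m : 'I_n -> M).
Hypothesis m_gen : forall w,
  exists c : 'I_n -> k, w = \sum_(i < n) kscale (c i) (m i).
Hypothesis m_free : forall c : 'I_n -> k,
  \sum_(i < n) kscale (c i) (m i) = 0 -> forall i, c i = 0.
Hypothesis m_shift : forall i j : 'I_n, j = i.+1 :> nat -> hx chi *: m i = m j.
Variable n_gt0 : (0 < n)%N.
Local Notation m0 := (m (Ordinal n_gt0)).

Lemma basis_shift (i : 'I_n) : hx chi ^+ i *: m0 = m i.
Proof using m_shift.
case: i => i lt_in /=; elim: i lt_in => [|i IHi] lt_in.
  by rewrite scale1r; congr m; apply: val_inj.
by rewrite exprS -scalerA (IHi (ltnW lt_in)); apply: m_shift.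
Qed.

(** If [m_i = x^i m_0] is a basis, then no nonzero polynomial of degree less
    than [n] kills [m_0]; so a graded prime power of degree [n] which does is
    the annihilator of [m_0]. *)
Lemma basis_cyclic lambda f t : monic_irreducible f -> (0 < t)%N ->
  size (gprime s f t) = n.+1 -> weight_space lambda m0 ->
  px (gprime s f t) *: m0 = 0 -> cyclic_type s m0 lambda f t.
Proof.
move=> mi_f t_gt0 sz hw hann; split=> // [|w]; last first.
  have [c ->] := m_gen w; exists (\sum_(i < n) c i *: hx chi ^+ i).
  rewrite scaler_suml; apply: eq_bigr => i _.
  by rewrite -kscale_h basis_shift.
set q := gprime s f t.-1 => qm0.
have lt_qn : (size q <= n)%N.
  rewrite -ltnS -sz !size_gprime ?mi_f.1 // ltnS ltn_pmul2r ?(step_gt0 hs) //.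
  rewrite ltn_pmul2l ?prednK //.
  by case: mi_f => _ [+ _]; case: (size f) => [|[]].
have q_monic : q \is monic by apply/(gprime_monic hs)/(mi_f.1).
suff q0 : q = 0 by move: q_monic; rewrite q0 monicE lead_coef0 eq_sym oner_eq0.
apply/polyP=> i; rewrite coef0.
have [le_ni|lt_in] := leqP n i; first by rewrite nth_default // (leq_trans lt_qn).
apply: (m_free (c := fun i => q`_i) _ (Ordinal lt_in)).
rewrite -[RHS]qm0 (pxE_widen _ lt_qn).
by apply: eq_bigr => j _; rewrite basis_shift.
Qed.

End ShiftedBasis.

Section Representation.
Variables (n : nat) (r : mx_rep chi n).
Let m (i : 'I_n) : rep_module r := delta_mx i (0 : 'I_1).

Lemma rep_module_gen (w : rep_module r) :
  exists c : 'I_n -> k, w = \sum_(i < n) kscale (c i) (m i).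
Proof.
exists (fun i => w i 0).
rewrite [LHS](matrix_sum_delta (w : 'cV[k]_n)); apply: eq_bigr => i _.
by rewrite big_ord1 rep_module_k.
Qed.

Lemma rep_module_fin_dim : fin_dim (rep_module r).
Proof. by exists n, m; apply: rep_module_gen. Qed.

Lemma rep_module_free (c : 'I_n -> k) :
  \sum_(i < n) kscale (c i) (m i) = 0 -> forall i, c i = 0.
Proof.
under eq_bigr do rewrite rep_module_k.
move=> sum0 i; move/matrixP/(_ i 0): sum0; rewrite summxE (bigD1 i) //= big1.
  by rewrite !mxE !eqxx mulr1 addr0.
by move=> j ne_ji; rewrite !mxE eq_sym (negPf ne_ji) mulr0.
Qed.

End Representation.

Lemma Vt_cyclic lambda t (t_gt0 : (0 < t)%N) :
  cyclic_type s (Vt_basis chi lambda (Ordinal t_gt0)) lambda 'X t.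
Proof.
have shift := fun i j => @Vt_xS _ _ chi t lambda i j.
apply: (basis_cyclic (@rep_module_gen _ _) (@rep_module_free _ _)) => //.
- by split; [exact: monicX|exact: irreducible_polyX].
- by rewrite gprimeX size_polyXn.
- by move=> g; rewrite Vt_g mul1g.
have lt_t : (t.-1 < t)%N by rewrite prednK.
rewrite gprimeX pxXn -[X in _ ^+ X](prednK t_gt0) exprS -scalerA.
rewrite [_ ^+ _ *: _](basis_shift shift t_gt0 (Ordinal lt_t)).
by apply: Vt_xlast; rewrite /= prednK.
Qed.

Lemma Vpoly_dim_gt0 f t : in_Irr f -> (0 < t)%N ->
  (0 < (size (f ^+ t)).-1 * s)%N.
Proof.
move=> [_ [sz_f _] _] t_gt0; have [s_gt0 _ _] := hs.
rewrite size_exp !muln_gt0 t_gt0 s_gt0 !andbT.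
by case: (size f) sz_f => [|[]].
Qed.

Lemma Vpoly_cyclic lambda f t (irr_f : in_Irr f) (t_gt0 : (0 < t)%N) :
  cyclic_type s (Vpoly_basis hs lambda (Ordinal (Vpoly_dim_gt0 irr_f t_gt0)))
    lambda f t.
Proof.
have shift := fun i j => @Vpoly_xS _ _ _ _ hs lambda (f ^+ t) i j.
apply: (basis_cyclic (@rep_module_gen _ _) (@rep_module_free _ _)) => //.
- by case: irr_f.
- by rewrite size_gprime ?(step_in_Irr s irr_f) ?size_exp //; case: irr_f.
- by move=> g; rewrite Vpoly_g mul1g.
set N_gt0 := Vpoly_dim_gt0 _ _; set F := f ^+ t.
set N := ((size F).-1 * s)%N.
have lt_N : (N.-1 < N)%N by rewrite prednK.
have mF : F \is monic by have [mf _ _] := irr_f; apply: monic_exp.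
have szF : size F = (size F).-1.+1 by rewrite prednK ?size_poly_gt0 ?monic_neq0.
rewrite /gprime (step_in_Irr s irr_f) -/F comp_polyE szF big_ord_recr /=.
rewrite -lead_coefE (eqP mF) scale1r px_scaleD.
rewrite -exprM pxXn (mulnC s) -/N -[X in _ ^+ X *: _](prednK (N_gt0 : 0 < N)%N).
rewrite exprS -scalerA.
rewrite [_ ^+ _ *: _](basis_shift shift N_gt0 (Ordinal lt_N)).
rewrite [X in _ + X](Vpoly_xlast hs lambda (i := Ordinal lt_N)) /= ?prednK //.
rewrite px_sum scaler_suml -big_split big1 // => i _ /=.
rewrite pxZ -exprM pxXn (mulnC s) -kscale_h.
rewrite [_ ^+ _ *: _](basis_shift shift N_gt0 (Ordinal (Vpoly_ord hs i))).
by rewrite kscaleNl subrr.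
Qed.

End ListedModules.

(** * Finite dimensional weight modules *)

Section FiniteDimension.
Variables (G : groupType) (k : fieldType) (chi : character G k).
Local Notation H := (hopf_ore chi).
Local Notation hmodType := (lmodType (hopf_ore chi)).
Local Notation px := (hpoly chi).
Implicit Types (M : hmodType) (h : H) (lambda mu : character G k).

(** Cayley-Hamilton for a matrix of [px r] on a generating family, which need
    not be free. *)
Lemma annihilating_polynomial M (r : {poly k}) : fin_dim M ->
  exists2 p : {poly k}, p != 0 & forall v : M, px (p \Po r) *: v = 0.
Proof.
case=> -[|n] [e gen].
  exists 1 => [|v]; first exact: oner_neq0.
  by have [c ->] := gen v; rewrite big_ord0 scaler0.
have [Z defZ] : exists Z : 'M[k]_n.+1,
    forall j, px r *: e j = \sum_i kscale (Z i j) (e i).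
  pose c j := sval (cid (gen (px r *: e j))).
  have cE j : px r *: e j = \sum_i kscale (c j i) (e i).
    exact: svalP (cid (gen (px r *: e j))).
  exists (\matrix_(i, j) c j i) => j; rewrite cE.
  by apply: eq_bigr => i _; rewrite mxE.
have actZ p j : px (p \Po r) *: e j = \sum_i kscale (horner_mx Z p i j) (e i).
  elim/poly_ind: p j => [|p c IHp] j.
    rewrite comp_poly0 px0 scale0r rmorph0 big1 // => i _.
    by rewrite mxE kscale0l.
  rewrite comp_poly_MXaddC px_scaleD px_scaleM defZ scaler_sumr pxC -/(kscale c _).
  under eq_bigr do rewrite h_kscale IHp kscale_sumr.
  rewrite exchange_big /=.
  under eq_bigr do under eq_bigr do rewrite kscaleA.
  under eq_bigr do rewrite -kscale_suml.
  have -> : kscale c (e j) = \sum_i kscale (c%:M i j) (e i).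
    rewrite (bigD1 j) //= big1 => [|i ne_ij]; rewrite mxE ?eqxx ?addr0 //.
    by rewrite (negPf ne_ij) kscale0l.
  rewrite -big_split; apply: eq_bigr => i _ /=; rewrite -kscaleDl; congr kscale.
  rewrite rmorphD rmorphM /= horner_mx_X horner_mx_C !mxE; congr (_ + _).
  by apply: eq_bigr => l _; rewrite mulrC.
exists (char_poly Z) => [|v]; first by rewrite monic_neq0 ?char_poly_monic.
have [c ->] := gen v; rewrite scaler_sumr big1 // => j _.
rewrite h_kscale actZ Cayley_Hamilton big1 ?kscale0r // => i _.
by rewrite mxE kscale0l.
Qed.

(** The weight components of the vectors of a finite generating family still
    generate. *)
Lemma weight_generating_family M : fin_dim M -> weight_module M ->
  exists (I : finType) (l : I -> character G k) (e : I -> M),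
    (forall i, weight_space (l i) (e i)) /\
    forall v, exists c : I -> k, v = \sum_i kscale (c i) (e i).
Proof.
case=> n [e gen] [wM _].
pose L i := sval (cid (wM (e i))).
have hL i : exists w : character G k -> M,
    [/\ uniq (L i), forall lambda, lambda \in L i -> weight_space lambda (w lambda)
      & e i = \sum_(lambda <- L i) w lambda].
  exact: svalP (cid (wM (e i))).
pose w i := sval (cid (hL i)).
have wL i j : j \in L i -> weight_space j (w i j).
  by have [_ + _] := svalP (cid (hL i)); apply.
have def_e i : e i = \sum_(lambda <- L i) w i lambda.
  by have [] := svalP (cid (hL i)).
pose I := {i : 'I_n & 'I_(size (L i))}.
pose l (ij : I) := nth 1%g (L (tag ij)) (tagged ij).
exists I, l, (fun ij => w (tag ij) (l ij)).
split=> [ij|v]; first by apply/wL/mem_nth.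
have [c ->] := gen v; exists (fun ij => c (tag ij)).
rewrite -(sig_big_dep xpredT (fun _ => xpredT)
  (fun i (j : 'I_(size (L i))) => kscale (c i) (w i (nth 1%g (L i) j)))) /=.
apply: eq_bigr => i _.
by rewrite {1}def_e (big_nth 1%g) big_mkord kscale_sumr.
Qed.

(** The coordinate functions of a basis of weight vectors; the basis is a
    generating subset of least cardinality. *)
Lemma weight_functional M (u : M) : fin_dim M -> weight_module M -> u <> 0 ->
  exists (phi : M -> k) (mu : character G k),
    [/\ {morph phi : v w / v + w}, forall c v, phi (kscale c v) = c * phi v,
        forall g v, phi (hgrp chi g *: v) = mu g * phi v & phi u != 0].
Proof.
move=> fM wM u_neq0; have [I [l [e [we gen]]]] := weight_generating_family fM wM.
pose Q (S : {set I}) :=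
  `[< forall v, exists c : I -> k, v = \sum_(i in S) kscale (c i) (e i) >].
have QT : Q setT.
  apply/asboolP => v; have [c ->] := gen v; exists c.
  by apply: eq_bigl => i; rewrite inE.
case: (arg_minnP (fun S : {set I} => #|S|) QT) => S /asboolP genS minS.
have freeS (c : I -> k) : \sum_(i in S) kscale (c i) (e i) = 0 ->
    forall i, i \in S -> c i = 0.
  move=> sum0 j jS; apply/eqP; apply: contraT => cj_neq0.
  (* a relation involving [e j] expresses [e j] through the rest of [S] *)
  suff /minS : Q (S :\ j) by rewrite (cardsD1 j S) jS ltnn.
  apply/asboolP => v; have [d ->] := genS v.
  (* subtract the multiple of the relation that cancels the coefficient of [e j] *)
  exists (fun i => d i - d j / c j * c i).
  under [RHS]eq_bigr do rewrite kscaleDl kscaleNl -kscaleA.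
  rewrite big_split sumrN -kscale_sumr /=.
  have split_j (F : I -> M) : \sum_(i in S) F i = F j + \sum_(i in S :\ j) F i.
    rewrite (bigD1 j) //=; congr (_ + _); apply: eq_bigl => i.
    by rewrite !inE andbC.
  have -> : \sum_(i in S :\ j) kscale (c i) (e i) = - kscale (c j) (e j).
    by apply/eqP; rewrite -addr_eq0 addrC -split_j sum0.
  have -> : kscale (d j / c j) (- kscale (c j) (e j)) = - kscale (d j) (e j).
    by rewrite kscaleNr kscaleA divfK.
  by rewrite opprK addrC split_j.
pose coord v := sval (cid (genS v)).
have coordE v : v = \sum_(i in S) kscale (coord v i) (e i).
  exact: svalP (cid (genS v)).
have coord_uniq v (c : I -> k) : v = \sum_(i in S) kscale (c i) (e i) ->
    forall i, i \in S -> coord v i = c i.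
  move=> def_v i iS; apply/eqP; rewrite -subr_eq0; apply/eqP.
  apply: (freeS (fun i => coord v i - c i)) => //.
  under eq_bigr do rewrite kscaleDl kscaleNl.
  by rewrite big_split sumrN /= -coordE; apply/eqP; rewrite subr_eq0; apply/eqP.
have [j jS uj] : exists2 j, j \in S & coord u j != 0.
  apply: contra_notP u_neq0 => no_j; rewrite (coordE u) big1 // => i iS.
  have [->|ui] := eqVneq (coord u i) 0; first exact: kscale0l.
  by case: no_j; exists i.
exists (fun v => coord v j), (l j); split=> // [v w|c v|g v].
- rewrite (coord_uniq _ (fun i => coord v i + coord w i)) //.
  by under eq_bigr do rewrite kscaleDl; rewrite big_split -!coordE.
- rewrite (coord_uniq _ (fun i => c * coord v i)) //.
  by under eq_bigr do rewrite -kscaleA; rewrite -kscale_sumr -coordE.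
rewrite (coord_uniq _ (fun i => l i g * coord v i)) //.
under eq_bigr do rewrite mulrC -kscaleA -we -h_kscale.
by rewrite -scaler_sumr -coordE.
Qed.

End FiniteDimension.

(** * Indecomposable modules are cyclic *)

Section IndecomposableModules.
Variables (G : groupType) (k : fieldType) (chi : character G k).
Variables (s : nat) (hs : has_order chi s).
Local Notation H := (hopf_ore chi).
Local Notation px := (hpoly chi).
Implicit Types (M : lmodType H) (lambda mu : character G k).
Implicit Types (f p q : {poly k}) (t : nat).

Lemma px_comp_central q (h : H) : h * px (q \Po 'X^s) = px (q \Po 'X^s) * h.
Proof. by apply: central_px_comp; case: hs. Qed.

(** As [x^s] is central, coprime factors of a polynomial annihilating it split
    [M]. In an annihilating polynomial of least degree, one irreducible factor
    must therefore account for everything. *)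
Lemma indecomposable_primary M : fin_dim M -> indecomposable_weight_module M ->
  exists f t, monic_irreducible f /\
    forall v : M, px ((f ^+ t) \Po 'X^s) *: v = 0.
Proof.
move=> fM iM.
pose Q n := `[< exists p, [/\ p != 0, size p = n
  & forall v : M, px (p \Po 'X^s) *: v = 0] >].
have exQ : exists n, Q n.
  have [p p_neq0 p_ann] := annihilating_polynomial 'X^s fM.
  by exists (size p); apply/asboolP; exists p.
case: (ex_minnP exQ) => n /asboolP[p [p_neq0 szp p_ann]] min_n.
have p_gt1 : (1 < size p)%N.
  rewrite ltnNge; apply/negP => /size1_polyC def_p.
  have [_ nM _] := iM; apply: nM => v.
  have := p_ann v; rewrite def_p comp_polyC pxC; apply: kscale_eq0.
  by move: p_neq0; rewrite {1}def_p polyC_eq0.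
have [f [mf irr_f fp]] := exists_irreducible_factor p_gt1.
exists f; have [t [q [def_p cfq]]] := irreducible_power_split irr_f p_neq0.
exists t; split=> //.
have cftq : coprimep (f ^+ t) q by apply: coprimep_expl.
have [[a b] /= ab] := Bezout_eq1_coprimepP _ _ cftq.
have bezout (v : M) :
    v = px ((b * q) \Po 'X^s) *: v + px ((a * f ^+ t) \Po 'X^s) *: v.
  by rewrite -px_scaleD -comp_polyD addrC ab comp_polyC pxC !scale1r.
pose U := central_kernel M (px_comp_central (f ^+ t)).
pose W := central_kernel M (px_comp_central q).
have [v Uv Wv|v|U0|W0] := @indecomposable_split _ _ _ M U W iM.
- rewrite [v]bezout !comp_polyM !px_scaleM.
  by rewrite [X in _ *: X]Wv [X in _ + _ *: X]Uv !scaler0 addr0.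
- exists (px ((b * q) \Po 'X^s) *: v), (px ((a * f ^+ t) \Po 'X^s) *: v).
  split; last exact: bezout.
    rewrite /= -px_scaleM -comp_polyM mulrCA -def_p comp_polyM px_scaleM p_ann.
    exact: scaler0.
  rewrite /= -px_scaleM -comp_polyM mulrCA [q * _]mulrC -def_p comp_polyM px_scaleM.
  by rewrite p_ann scaler0.
- have q_neq0 : q != 0 by apply: contraNneq p_neq0 => q0; rewrite def_p q0 mulr0.
  have /min_n : Q (size q).
    apply/asboolP; exists q; split=> // v.
    by apply: U0; rewrite /= -px_scaleM -comp_polyM -def_p p_ann.
  have t_gt0 : (0 < t)%N.
    case: t def_p {cftq ab bezout U U0} => // def_p; move: fp.
    move: cfq; rewrite def_p mul1r irreducible_poly_coprime //.
    by move=> /negPf->.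
  have ft_gt1 : (0 < (size (f ^+ t)).-1)%N.
    rewrite size_exp muln_gt0 t_gt0 andbT.
    by case: irr_f => + _; case: (size f) => [|[]].
  rewrite -szp def_p size_mul ?expf_neq0 ?(irredp_neq0 irr_f) //.
  case: (size (f ^+ t)) ft_gt1 => [|[]] // m _.
  by rewrite !addSn /= leqNgt ltnS leq_addl.
move=> v; apply: W0; rewrite /= -px_scaleM -comp_polyM mulrC -def_p.
exact: p_ann.
Qed.

(** The least power of the graded prime that kills [M], and a weight component
    not killed by the previous power. *)
Lemma indecomposable_socle_vector M :
  fin_dim M -> indecomposable_weight_module M ->
  exists f t lambda (v : M), [/\ monic_irreducible f,
    forall w : M, px (gprime s f t) *: w = 0, weight_space lambda v
    & px (gprime s f t.-1) *: v <> 0].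
Proof.
move=> fM iM; have [f [t0 [mi_f ann0]]] := indecomposable_primary fM iM.
pose Q t := `[< forall w : M, px (gprime s f t) *: w = 0 >].
have exQ : exists t, Q t.
  have [f_X|irr_f] := monic_irreducible_cases mi_f.
    (* for [f = 'X], [f^t0] in [x^s] is [x^(s * t0)] *)
    exists (s * t0)%N; apply/asboolP => w; rewrite f_X gprimeX.
    by have := ann0 w; rewrite f_X rmorphXn /= comp_polyX -exprM.
  by exists t0; apply/asboolP => w; rewrite /gprime (step_in_Irr s irr_f).
case: (ex_minnP exQ) => t /asboolP ann min_t.
have [[/(_ _)wM _] nM _] := iM.
have t_gt0 : (0 < t)%N.
  case: t ann {min_t} => // ann; case: nM => v.
  by have := ann v; rewrite /gprime comp_polyC pxC !scale1r.
have [w w_neq0] : exists w : M, px (gprime s f t.-1) *: w <> 0.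
  apply/existsNP => ann'; have /min_t : Q t.-1 by apply/asboolP.
  by rewrite -ltnS prednK // ltnn.
have [L [v [_ vL def_w]]] := wM w.
have [lambda lambdaL v_neq0] : exists2 lambda, lambda \in L &
    px (gprime s f t.-1) *: v lambda <> 0.
  apply: contra_notP w_neq0 => no_l; rewrite def_w scaler_sumr big1_seq // => mu /= muL.
  by apply: contrapT => nz; apply: no_l; exists mu.
by exists f, t, lambda, (v lambda); split=> //; apply: vL.
Qed.

(** The complement of [H v] is the largest submodule in the kernel of a weight
    functional [phi] which is nonzero on the socle vector of [H v]. It meets
    [H v] trivially, so the matrix [phi (x^(i + j) v)] is invertible; as the
    complement is cut out by the [n] equations [phi (x^i w) = 0], [i < n], any
    [w] can be corrected by an element of [H v] to satisfy them. *)
Lemma indecomposable_cyclic M : fin_dim M -> indecomposable_weight_module M ->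
  exists f t lambda (v : M), monic_irreducible f /\ cyclic_type s v lambda f t.
Proof.
move=> fM iM.
have [f [t [lambda [v [mi_f ann wv sv]]]]] := indecomposable_socle_vector fM iM.
exists f, t, lambda, v; split=> //; split=> //.
set u0 := px _ *: v in sv.
have [wM _ _] := iM.
have [phi [mu [phiD phiZ phig phi_u0]]] := weight_functional fM wM sv.
have phi0 : phi 0 = 0 by rewrite -(kscale0l (0 : M)) phiZ mul0r.
have phi_sum := big_morph phi phiD phi0.
set P := gprime s f t in ann *; pose n := (size P).-1.
have mP : P \is monic by apply: (gprime_monic hs); case: mi_f.
have szP : size P = n.+1 by rewrite prednK // size_poly_gt0 monic_neq0.
pose U := cyclic_submodule v; pose C := kernel_core phiD.
have inC (w : M) : (forall i, (i < n)%N -> phi (hx chi ^+ i *: w) = 0) -> C w.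
  move=> phi_w h; elim/hb_ind: h => [|p q hp hq|c p hp|[g j]].
  - by rewrite scale0r.
  - by rewrite scalerDl phiD hp hq addr0.
  - by rewrite -kscale_h phiZ hp mulr0.
  rewrite hb_grpx -scalerA phig -pxXn (divp_eq 'X^j P) px_scaleD px_scaleM ann.
  rewrite scaler0 add0r (@pxE_widen _ _ _ _ n); last first.
    by rewrite -ltnS -szP ltn_modp monic_neq0.
  rewrite phi_sum big1 ?mulr0 // => i _.
  by rewrite phiZ phi_w ?mulr0.
have UC0 (w : M) : U w -> C w -> w = 0.
  move=> [h ->] Cw; have [q hq] := weight_px lambda h.
  rewrite (hq _ _ wv) in Cw *; apply: contrapT => qv.
  have [|h' def_u0] := reach_socle hs mi_f wv (ann v) (q := q).
    apply/negP => /dvdpP[r def_q]; apply: qv.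
    by rewrite def_q px_scaleM ann scaler0.
  by move: (Cw h'); rewrite def_u0; apply/eqP.
pose A : 'M[k]_n := \matrix_(i, j) phi (hx chi ^+ (i + j) *: v).
have phi_xpx (c : 'rV[k]_n) (i : 'I_n) :
    phi (hx chi ^+ i *: (px (rVpoly c) *: v)) = (c *m A) 0 i.
  rewrite (@pxE_widen _ _ _ _ n) ?size_poly // scaler_sumr phi_sum mxE.
  apply: eq_bigr => j _; rewrite h_kscale phiZ coef_rVpoly_ord mxE scalerA -exprD.
  by rewrite addnC.
have unitA : A \in unitmx.
  rewrite unitmxE unitfE; apply/negP => /det0P[c c_neq0 cA0].
  have pv0 : px (rVpoly c) *: v = 0.
    apply: UC0; first by exists (px (rVpoly c)).
    by apply: inC => i lt_in; rewrite (phi_xpx c (Ordinal lt_in)) cA0 mxE.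
  have szc : (size (rVpoly c) < size P)%N by rewrite szP ltnS size_poly.
  case/negP: c_neq0; rewrite -(inj_eq (can_inj rVpolyK)) linear0.
  apply: contraLR szc => c_neq0; rewrite -leqNgt dvdp_leq //.
  apply: contraT => /(reach_socle hs mi_f wv (ann v))[h].
  by rewrite pv0 scaler0 => /esym/sv.
have UC_total (w : M) : exists u c, [/\ U u, C c & w = u + c].
  pose c := (\row_i phi (hx chi ^+ i *: w)) *m invmx A.
  exists (px (rVpoly c) *: v), (w - px (rVpoly c) *: v); split.
  - by exists (px (rVpoly c)).
  - apply: inC => i lt_in.
    rewrite -[- (px _ *: _)]kscale1 kscaleNr -kscaleNl scalerDr h_kscale phiD phiZ.
    by rewrite (phi_xpx c (Ordinal lt_in)) mulmxKV // mxE mulN1r subrr.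
  by rewrite addrC subrK.
have [U_0|C_0 w] := indecomposable_split iM UC0 UC_total.
  by case: sv; apply: U_0; exists (px (gprime s f t.-1)).
by have [u [c [Uu Cc ->]]] := UC_total w; rewrite (C_0 c Cc) addr0.
Qed.

End IndecomposableModules.

(** * Change of generator and the classification *)

Section Classes.
Variables (G : groupType) (k : fieldType) (chi : character G k).
Variables (s : nat) (hs : has_order chi s).
Local Notation px := (hpoly chi).
Implicit Types (lambda sigma : character G k) (f : {poly k}).

(** For [f <> 'X] the action of [x] is invertible, so that [x^i v] generates as
    well as [v]: only the class of [lambda] modulo [chi] is determined. *)
Lemma cyclic_shift (M : lmodType (hopf_ore chi)) (v : M) lambda f t i :
  in_Irr f -> cyclic_type s v lambda f t ->
  cyclic_type s (hx chi ^+ i *: v) (chi ^+ i * lambda)%g f t.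
Proof.
move=> irr_f cv; have [s_gt0 _ _] := hs.
have cPX : coprimep 'X^i (gprime s f t).
  apply: coprimep_expl; rewrite coprimep_sym /gprime (step_in_Irr s irr_f).
  rewrite -(coprimep_pexpr _ _ s_gt0) -[X in coprimep _ (X ^+ _)](comp_polyX 'X).
  rewrite comp_polyX -[X in coprimep _ X](comp_polyX 'X^s).
  by apply/coprimep_comp_poly/coprimep_expl/in_Irr_coprimeX.
have [[a b] /= ab] := Bezout_eq1_coprimepP _ _ cPX.
have back : v = px a *: (hx chi ^+ i *: v).
  rewrite -pxXn -px_scaleM -[px (_ * _) *: _]addr0 -[X in _ + X](scaler0 _ (px b)).
  by rewrite -(cyclic_ann cv) -px_scaleM -px_scaleD ab pxC !scale1r.
have xpx q : px q *: (hx chi ^+ i *: v) = hx chi ^+ i *: (px q *: v).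
  by rewrite -pxXn -!px_scaleM mulrC.
split=> [|||w].
- exact/weight_space_xn/(cyclic_weight cv).
- by rewrite xpx (cyclic_ann cv) scaler0.
- move=> x0; apply: (cyclic_socle cv); rewrite [v in LHS]back.
  by rewrite -px_scaleM mulrC px_scaleM x0 scaler0.
have [h ->] := cyclic_gen cv w.
by exists (h * px a); rewrite -scalerA -back.
Qed.

(** The order of [chi] is finite, so its negative powers are positive powers. *)
Lemma same_class_shift sigma lambda :
  same_class chi sigma lambda -> exists i, (chi ^+ i * lambda)%g = sigma.
Proof.
have [s_gt0 chis _] := hs.
case=> n [] /(congr1 (fun mu => sigma * mu)%g); rewrite mulVKg => ->.
  exists (n * s.-1)%N; rewrite [(sigma * _)%g]char_mulC mulgA -expgnDr.
  by rewrite addnC -mulnS prednK // mulnC expgnA chis expg1n mul1g.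
by exists n; rewrite [(sigma * _)%g]char_mulC mulVKg.
Qed.

Lemma shift_same_class sigma i : same_class chi sigma (chi ^+ i * sigma)%g.
Proof. by exists i; left; rewrite char_mulC mulgK. Qed.

End Classes.

Theorem corollary4p19 (k : fieldType) (G : groupType)
    (chi : character G k) (a : G)
    (a_central : forall g : G, (a * g = g * a)%g) (chi_a : chi a <> 1)
    (s : nat) (chi_s : has_order chi s)
    (T : character G k -> Prop) (T_transversal : class_transversal chi T) :
  representative_family (@fin_dim_indecomposable G k chi)
    (admissible T) (rep_object chi_s).
Proof.
have mi_X : monic_irreducible ('X : {poly k}).
  by split; [exact: monicX|exact: irreducible_polyX].
have mi_Irr (f : {poly k}) : in_Irr f -> monic_irreducible f by case.
split.
- case=> [t lambda t_gt0|sigma f t [_ irr_f t_gt0]]; split.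
  + exact: rep_module_fin_dim.
  + by have := cyclic_indecomposable chi_s mi_X (Vt_cyclic chi_s lambda t_gt0).
  + exact: rep_module_fin_dim.
  by have := cyclic_indecomposable chi_s (mi_Irr _ irr_f)
    (Vpoly_cyclic chi_s sigma irr_f t_gt0).
- move=> M [fM iM].
  have [f [t [lambda [v [mi_f cv]]]]] := indecomposable_cyclic chi_s fM iM.
  have t_gt0 := cyclic_gt0 cv.
  have [f_X|irr_f] := monic_irreducible_cases mi_f.
    rewrite f_X in cv; exists (IdxVt t lambda) => //.
    by have := cyclic_isomorphic chi_s mi_X cv (Vt_cyclic chi_s lambda t_gt0).
  have [sigma [[T_sigma cl_sigma] _]] := T_transversal lambda.
  have [i def_sigma] := same_class_shift chi_s cl_sigma.
  exists (IdxVpoly sigma f t) => //.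
  have := cyclic_shift chi_s i irr_f cv; rewrite def_sigma => cv'.
  by have := cyclic_isomorphic chi_s mi_f cv'
    (Vpoly_cyclic chi_s sigma irr_f t_gt0).
move=> [t lambda|sigma f t] [u mu|tau g u] /=.
- move=> t_gt0 u_gt0 [phi bij_phi].
  have ct := cyclic_transport bij_phi (Vt_cyclic chi_s lambda t_gt0).
  have [_ -> _ eq_mu] := cyclic_unique chi_s mi_X mi_X ct
    (Vt_cyclic chi_s mu u_gt0).
  by rewrite eq_mu.
- move=> t_gt0 [_ irr_g u_gt0] [phi bij_phi].
  have ct := cyclic_transport bij_phi (Vt_cyclic chi_s lambda t_gt0).
  have [def_X _ _ _] := cyclic_unique chi_s mi_X (mi_Irr _ irr_g) ct
    (Vpoly_cyclic chi_s tau irr_g u_gt0).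
  by have [_ _] := irr_g; rewrite -def_X.
- move=> [_ irr_f t_gt0] u_gt0 [phi bij_phi].
  have ct := cyclic_transport bij_phi (Vpoly_cyclic chi_s sigma irr_f t_gt0).
  have [def_X _ _ _] := cyclic_unique chi_s (mi_Irr _ irr_f) mi_X ct
    (Vt_cyclic chi_s mu u_gt0).
  by have [_ _] := irr_f; rewrite def_X.
move=> [T_sigma irr_f t_gt0] [T_tau irr_g u_gt0] [phi bij_phi].
have ct := cyclic_transport bij_phi (Vpoly_cyclic chi_s sigma irr_f t_gt0).
have [<- <- [j def_tau] _] := cyclic_unique chi_s
  (mi_Irr _ irr_f) (mi_Irr _ irr_g) ct
  (Vpoly_cyclic chi_s tau irr_g u_gt0).
suff -> : sigma = tau by [].
have [rho [_ rho_uniq]] := T_transversal tau.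
rewrite -(rho_uniq sigma); last first.
  by rewrite def_tau; split=> //; apply: shift_same_class.
rewrite -(rho_uniq tau) //; split=> //.
by have := shift_same_class chi tau 0; rewrite mul1g.
Qed.
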